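(* For $n\in\mathbb{N}$ let $$f_n(x)=\frac{\sqrt{3n}}{\pi}x+\frac{\sqrt{3n}}{\pi}\ln\frac{\sqrt{3n}}{\pi}.$$ For fixed $x,y\in\mathbb{R}$, $$\lim_{n\to\infty}\mathbb{P}_n\big(\ell(\lambda^-)\le f_n(x),\ \ell(\lambda^+)\le f_n(y)\big)=e^{-(e^{-x}+e^{-y})}.$$
   Context: A partition is a finite non-increasing sequence of positive integers (possibly empty); $|\lambda|$ is the sum of its parts and $\ell(\lambda)$ the number of parts. A concave composition of $n$ is a triple $(\lambda^-,c,\lambda^+)$ with $c\ge0$ an integer (the central part), $\lambda^-,\lambda^+$ partitions all of whose parts exceed $c$, and $|\lambda^-|+c+|\lambda^+|=n$; it corresponds to the sequence $\lambda^-_1\ge\dots\ge\lambda^-_L>c<\lambda^+_1\le\dots\le\lambda^+_R$. $\mathbb{P}_n$ is the uniform probability measure on the set of concave compositions of $n$ (the paper works under the standing convention that the central part is $c=0$, i.e. $\mathbb{P}_n$ is uniform on pairs $(\lambda^-,\lambda^+)$ of partitions with $|\lambda^-|+|\lambda^+|=n$). *)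

(* Defs.v *)
From HB Require Import structures.
From mathcomp Require Import all_boot all_order all_algebra finmap.
From mathcomp Require Import all_classical all_reals all_analysis.
Set Implicit Arguments.
Unset Strict Implicit.
Unset Printing Implicit Defensive.
Import Order.TTheory GRing.Theory Num.Theory.
Import numFieldNormedType.Exports.
Local Open Scope classical_set_scope.
Local Open Scope ring_scope.

Definition is_partition (s : seq nat) : bool :=
  sorted geq s && all (fun k => 0 < k)%N s.

(* A triple (lambda^-, c, lambda^+). Both sides are stored as partitions, i.e.
   listed from the largest part down, so the associated sequence is
   lambda^-, then c, then lambda^+ read backwards. *)
Definition triple : Type := (seq nat * nat * seq nat)%type.

Definition lambda_minus (t : triple) : seq nat := t.1.1.
Definition central (t : triple) : nat := t.1.2.
Definition lambda_plus (t : triple) : seq nat := t.2.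

Definition is_concave_composition (n : nat) (t : triple) : bool :=
  [&& is_partition (lambda_minus t), is_partition (lambda_plus t),
      all (fun k => central t < k)%N (lambda_minus t),
      all (fun k => central t < k)%N (lambda_plus t) &
      (sumn (lambda_minus t) + central t + sumn (lambda_plus t) == n)%N].

(* Sample space: the central part is 0 by convention, so that its elements are
   the pairs of partitions with |lambda^-| + |lambda^+| = n. *)
Definition concave_compositions (n : nat) : set triple :=
  [set t | is_concave_composition n t /\ central t = 0%N].

(* Uniform probability of the event E on a finite nonempty set A; [fset_set]
   is only meaningful on finite sets, see [finite_concave_compositions] and
   [concave_compositions_neq0]. *)
Definition uniform_prob (R : realType) (T : choiceType) (A E : set T) : R :=
  #|` fset_set (A `&` E)|%:R / #|` fset_set A|%:R.

Definition Pn (R : realType) (n : nat) (E : set triple) : R :=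
  uniform_prob R (concave_compositions n) E.

Definition f_ (R : realType) (n : nat) (x : R) : R :=
  Num.sqrt (3 * n%:R) / pi * x
  + Num.sqrt (3 * n%:R) / pi * ln (Num.sqrt (3 * n%:R) / pi).

Lemma concave_compositionsP (n : nat) (t : triple) :
  concave_compositions n t <->
  [/\ is_partition (lambda_minus t), is_partition (lambda_plus t),
      central t = 0%N & (sumn (lambda_minus t) + sumn (lambda_plus t) = n)%N].
Proof.
split=> [[/and5P[pm pp _ _ /eqP sn] c0]|[pm pp c0 sn]].
  by split=> //; rewrite -sn c0 addn0.
split=> //; apply/and5P; rewrite c0; split=> //.
- by case/andP: pm.
- by case/andP: pp.
- by rewrite addn0 sn.
Qed.

Lemma finite_partitions (n : nat) :
  finite_set [set s : seq nat | is_partition s /\ (sumn s <= n)%N].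
Proof.
pose F (b : n.-bseq 'I_n.+1) : seq nat := map val b.
apply: (@sub_finite_set _ _ (F @` setT)); last first.
  by apply: finite_image; exact: finite_finset.
move=> s /= [/andP[_ pos] sn].
have sz : (size s <= n)%N.
  apply: leq_trans sn; elim: s pos {F} => //= k s IH /andP[k0 ps].
  by rewrite -add1n leq_add // IH.
have le k : k \in s -> (k < n.+1)%N.
  move=> ks; rewrite ltnS (leq_trans _ sn)//.
  elim: s ks {pos sn sz} => //= j s IH; rewrite inE => /orP[/eqP->|/IH].
    by rewrite leq_addr.
  by move=> /leq_trans; apply; rewrite leq_addl.
have szi : (size [seq inord k : 'I_n.+1 | k <- s] <= n)%N by rewrite size_map.
exists (Bseq szi) => //; rewrite /F /= -map_comp -[RHS]map_id.
by apply/eq_in_map => k ks /=; rewrite inordK // le.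
Qed.

Lemma finite_concave_compositions (n : nat) :
  finite_set (concave_compositions n).
Proof.
pose A := [set s : seq nat | is_partition s /\ (sumn s <= n)%N].
apply: (@sub_finite_set _ _ ((A `*` [set 0%N]) `*` A)).
  move=> t /concave_compositionsP[pm pp c0 sn].
  split; first split; rewrite //= /A /=; split=> //; rewrite -sn ?leq_addr//.
  by rewrite leq_addl.
by do 2?apply: finite_setX => //; exact: finite_partitions.
Qed.

Lemma concave_compositions_neq0 (n : nat) : concave_compositions n !=set0.
Proof.
exists (if n is 0 then [::] else [:: n], 0%N, [::]).
by apply/concave_compositionsP; case: n => //= n; rewrite /lambda_minus /= !addn0.
Qed.

(* Main.v *)
Require Import Defs.
From HB Require Import structures.
From mathcomp Require Import all_boot all_order all_algebra finmap.
From mathcomp Require Import all_classical all_reals all_analysis.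
From mathcomp Require Import zify ring lra.
Set Implicit Arguments.
Unset Strict Implicit.
Unset Printing Implicit Defensive.
Import Order.TTheory GRing.Theory Num.Theory.
Import numFieldNormedType.Exports.
Local Open Scope classical_set_scope.
Local Open Scope ring_scope.

(** Write p(n) for the number of pairs of partitions of total size n, q = e^(-t)
with t = pi / sqrt (3 n), and G(q) for the product of the (1 - q^k)^(-2). The
number of pairs with at most a and at most b parts has generating function
G(q) times the product of 1 - q^k over k > a and over k > b. Hence its ratio to
p(n) is obtained from the ratios p(n - m) / p(n) by applying the corresponding
product of difference operators, and if p(n - m) / p(n) is close to q^m, this
yields the product of the 1 - q^k, which tends to exp(- e^(-x) - e^(-y)).

No circle method is needed for the closeness p(n - m) / p(n) ~ q^m. The uniform
measure on the pairs of size n is the Boltzmann measure (all multiplicities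
independent geometric) conditioned on an event whose probability is at least
exp(- O(n^(3/8))), by Chernoff bounds on both sides and the monotonicity of p.
Such a conditioning cannot move the mean number of the d in an interval of
length n^(15/32) that occur as parts: by convexity of the cumulant generating
function, this mean is close to the sum of the q^d. But d occurs as a part with
probability exactly p(n - d) / p(n), which is monotone in d, so that
p(n - d) / p(n) is close to q^d for d <= sqrt n; multiplying such estimates
reaches the m of order sqrt n * ln n and beyond that matter. *)

(** * Counting by generating functions *)

(** Coefficients of the series of [f] times 1 / (1 - q^k). The values lie in any additive monoid,
    since naturals, reals and polynomials all occur. *)
Definition geo (V : nmodType) (k : nat) (f : nat -> V) (n : nat) : V :=
  \sum_(j < n.+1 | (j * k <= n)%N) f (n - j * k)%N.

(** Coefficients of the product of the 1 / (1 - q^k) over k in the list, with repetition: two copies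
    of a part size stand for the two partitions of a pair. *)
Definition gcount : seq nat -> nat -> nat :=
  foldr (@geo nat) (fun n => (n == 0)%N : nat).

Definition parts (N : nat) : seq nat := rev (iota 1 N).

Lemma partsS N : parts N.+1 = N.+1 :: parts N.
Proof. by rewrite /parts -{1}(addn1 N) iotaD rev_cat add1n. Qed.

Lemma parts_rcons N : parts N.+1 = [seq k.+1 | k <- parts N] ++ [:: 1%N].
Proof. by elim: N => // N IH; rewrite partsS {1}IH [in RHS]partsS. Qed.

Lemma geo_widen (V : nmodType) k (f : nat -> V) n m : (0 < k)%N -> (n <= m)%N ->
  geo k f n = \sum_(j < m.+1 | (j * k <= n)%N) f (n - j * k)%N.
Proof.
move=> k0 nm; rewrite /geo.
rewrite (big_ord_widen_cond m.+1 (fun j => (j * k <= n)%N)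
  (fun j => f (n - j * k)%N)) ?ltnS//.
apply: eq_bigl => j; rewrite andb_idr// ltnS; nia.
Qed.

(** F / (1 - q^k) = F + q^k F / (1 - q^k), read on coefficients. *)
Lemma geo_rec (V : nmodType) k (f : nat -> V) n : (0 < k)%N ->
  geo k f n = f n + (if (k <= n)%N then geo k f (n - k)%N else 0).
Proof.
move=> k0; rewrite {1}/geo big_mkcond big_ord_recl /= mul0n subn0; congr (_ + _).
case: leqP => kn; last first.
  by rewrite big1// => j _; rewrite /bump leq0n add1n ifF//; apply/negbTE; nia.
rewrite (@geo_widen _ _ _ _ n.-1)//; last lia.
rewrite prednK; last lia.
rewrite [RHS]big_mkcond; apply: eq_bigr => j _.
rewrite /bump leq0n add1n mulSn subnDA.
by have -> : (k + j * k <= n)%N = (j * k <= n - k)%N by lia.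
Qed.

Lemma geoC (V : nmodType) k l (f : nat -> V) n : (0 < k)%N -> (0 < l)%N ->
  geo k (geo l f) n = geo l (geo k f) n.
Proof.
move=> k0 l0.
have E k' l' : (0 < k')%N -> (0 < l')%N -> geo k' (geo l' f) n =
    \sum_(j < n.+1) \sum_(i < n.+1)
      if (j * k' + i * l' <= n)%N then f (n - (j * k' + i * l'))%N else 0.
  move=> k0' l0'; rewrite /geo big_mkcond; apply: eq_bigr => j _.
  case: leqP => jk; last by rewrite big1// => i _; rewrite ifF//; lia.
  rewrite -/(geo l' f (n - j * k')) (@geo_widen _ _ _ _ n)// ?leq_subr//.
  rewrite big_mkcond; apply: eq_bigr => i _; rewrite subnDA.
  by have -> : (i * l' <= n - j * k')%N = (j * k' + i * l' <= n)%N by lia.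
rewrite (E k l)// (E l k)// exchange_big/=.
by apply: eq_bigr => j _; apply: eq_bigr => i _; rewrite addnC.
Qed.

Lemma eq_geo (V : nmodType) k (f g : nat -> V) : f =1 g -> geo k f =1 geo k g.
Proof. by move=> fg n; apply: eq_bigr => j _. Qed.

Lemma geo_foldr (V : nmodType) k s (f : nat -> V) n : (0 < k)%N ->
  all (leq 1) s -> geo k (foldr (@geo V) f s) n = foldr (@geo V) (geo k f) s n.
Proof.
move=> k0; elim: s n => //= l s IH n /andP[l0 s0].
by rewrite geoC//; apply: eq_geo => m; apply: IH.
Qed.

Lemma gcount_perm s s' : all (leq 1) s -> perm_eq s s' ->
  gcount s =1 gcount s'.
Proof.
rewrite /gcount; move: (fun n => (n == 0)%N : nat) => f.
elim: s s' f => [|k s IH] s' f /=.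
  by move=> _; rewrite perm_sym => /perm_nilP -> n.
move=> /andP[k0 s0] ks'.
have ks : k \in s' by rewrite -(perm_mem ks') mem_head.
case/splitPr: ks ks' => s1 s2.
rewrite perm_sym perm_catC /= perm_cons perm_catC perm_sym => ss n.
have : all (leq 1) (s1 ++ s2) by rewrite -(perm_all _ ss).
rewrite all_cat => /andP[s10 s20].
rewrite (eq_geo k (IH _ f s0 ss)) !foldr_cat geo_foldr//=.
Qed.

Lemma gcount_parts_gt k s n : (n < k)%N -> gcount (k :: s) n = gcount s n.
Proof. by move=> nk; rewrite /= geo_rec 1?leqNgt ?nk ?addr0//; lia. Qed.

Lemma all_parts N : all (leq 1) (parts N).
Proof. by rewrite /parts all_rev; apply/allP => i; rewrite mem_iota => /andP[]. Qed.

Lemma gcount_catC s s' : all (leq 1) s -> all (leq 1) s' ->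
  gcount (s ++ s') =1 gcount (s' ++ s).
Proof. by move=> s0 s'0; apply: gcount_perm; rewrite ?all_cat ?s0// perm_catC. Qed.

Lemma gcount_stable N s n : (n <= N)%N ->
  gcount (parts N ++ s) n = gcount (parts n ++ s) n.
Proof.
elim: N => [|N IH]; first by rewrite leqn0 => /eqP ->.
rewrite leq_eqVlt => /predU1P[->//|]; rewrite ltnS => nN.
by rewrite partsS cat_cons gcount_parts_gt ?ltnS// IH.
Qed.

(** Parts above n do not affect the coefficient of q^n, so cutting both copies at n gives the
    coefficient of the full product G; see [gcount_p2]. *)
Definition p2 (n : nat) : nat := gcount (parts n ++ parts n) n.

Lemma gcount_p2 N n : (n <= N)%N -> gcount (parts N ++ parts N) n = p2 n.
Proof.
move=> nN; rewrite gcount_stable// gcount_catC ?all_parts//.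
by rewrite gcount_stable.
Qed.

Lemma p2_gt0 n : (0 < p2 n)%N.
Proof.
have : (0 < gcount [:: 1%N] n)%N.
  elim: n => [|n IH]; rewrite /= geo_rec//.
  by rewrite subn1; apply: leq_trans IH (leq_addl _ _).
have mono s : (0 < gcount [:: 1%N] n -> all (leq 1) s ->
    0 < gcount (s ++ [:: 1]) n)%N.
  elim: s => // k s IH; move=> /IH{}IH /=/andP[k0 /IH].
  by rewrite geo_rec// => h; apply: leq_trans h _; apply: leq_addr.
case: n mono => [//|n] mono n0.
rewrite /p2 (_ : parts n.+1 ++ parts n.+1 =
  (parts n.+1 ++ [seq k.+1 | k <- parts n]) ++ [:: 1%N]); last first.
  by rewrite -catA -parts_rcons.
by apply: mono => //; rewrite all_cat all_parts; apply/allP => i /mapP[j _ ->].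
Qed.

(** Splitting off one factor 1 / (1 - q) shows that the coefficient at n + 1 is the one at n plus a
    nonnegative term. *)
Lemma p2_le : {homo p2 : m n / (m <= n)%N >-> (m <= n)%N}.
Proof.
apply: homo_leq => //; first exact: leq_trans.
move=> n; rewrite -(@gcount_p2 n.+1 n)// -(@gcount_p2 n.+1 n.+1)//.
have /gcount_perm E : perm_eq (parts n.+1 ++ parts n.+1)
    (1%N :: [seq k.+1 | k <- parts n] ++ parts n.+1).
  by rewrite -cat1s catA perm_cat2r parts_rcons perm_catC.
rewrite !E ?all_cat ?all_parts//= [geo _ _ n.+1]geo_rec// subn1/=.
exact: leq_addl.
Qed.

(** * Pairs of partitions *)

Lemma is_partitionE s : is_partition s = pairwise geq s && all (leq 1) s.
Proof.
rewrite /is_partition sorted_pairwise// => j i k /=.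
by move=> ij jk; apply: leq_trans jk ij.
Qed.

(* Adding 1 to each of the [a] (possibly zero) parts, and its inverse. *)
Definition add_column (a : nat) (s : seq nat) : seq nat :=
  map succn s ++ nseq (a - size s) 1%N.

Definition del_column (s : seq nat) : seq nat := [seq k.-1 | k <- s & (1 < k)%N].

Lemma add_columnK a s : all (leq 1) s -> del_column (add_column a s) = s.
Proof.
move=> s0; rewrite /del_column /add_column filter_cat map_cat.
rewrite [X in _ ++ X](_ : _ = [::]) ?cats0; last by elim: (a - size s)%N.
by elim: s s0 => //= k s IH /andP[k0 /IH IHs]; rewrite ltnS k0 /= IHs.
Qed.

Lemma del_columnK s : is_partition s -> add_column (size s) (del_column s) = s.
Proof.
rewrite is_partitionE; elim: s => // k s IH /=.
rewrite /del_column /add_column /= => /andP[/andP[ks sp] /andP[k0 s0]].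
case: (ltnP 1 k) => k1 /=.
  rewrite prednK// subSS; congr (_ :: _).
  by rewrite -[RHS]IH// sp.
have -> : [seq x <- s | (1 < x)%N] = [::].
  rewrite (@eq_in_filter _ _ pred0) ?filter_pred0// => x xs /=.
  by apply/negbTE; rewrite -leqNgt; exact: leq_trans (allP ks _ xs) k1.
have -> : k = 1%N by lia.
rewrite /=; congr (_ :: _).
elim: s ks s0 {IH sp} => //= j s IH /andP[jk ks] /andP[j0 s0].
by congr (_ :: _); [lia | apply: IH].
Qed.

Lemma add_column_partition a s : (size s <= a)%N -> is_partition s ->
  [/\ is_partition (add_column a s), size (add_column a s) = a &
      sumn (add_column a s) = (sumn s + a)%N].
Proof.
move=> sa; rewrite !is_partitionE => /andP[sp s0]; split.
- rewrite /add_column pairwise_cat all_cat.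
  apply/andP; split; [apply/and3P; split|apply/andP; split].
  + apply/allrelP => x y /mapP[x' _ ->] /nseqP[-> _] //.
  + by rewrite pairwise_map; apply: sub_pairwise sp => x y.
  + apply/(pairwiseP 0%N) => i j; rewrite !inE size_nseq => ia ja ij.
    by rewrite !nth_nseq ia ja.
  + by apply/allP => x /mapP[x' _ ->].
  + by apply/allP => x /nseqP[->].
- by rewrite /add_column size_cat size_map size_nseq subnKC.
- rewrite /add_column sumn_cat sumn_nseq mul1n.
  have -> : sumn (map succn s) = (sumn s + size s)%N.
    by elim: s {sa sp s0} => //= k s ->; lia.
  by rewrite -addnA subnKC.
Qed.

Lemma del_column_partition s : is_partition s -> is_partition (del_column s).
Proof.
rewrite !is_partitionE => /andP[sp s0]; apply/andP; split.
  rewrite /del_column pairwise_map.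
  apply: (@sub_pairwise _ geq); last exact: pairwise_filter.
  by move=> x y /=; lia.
by apply/allP => x /mapP[y]; rewrite mem_filter => /andP[y1 _] ->; lia.
Qed.

Lemma size_del_column s : (size (del_column s) <= size s)%N.
Proof. by rewrite size_map size_filter count_size. Qed.

(** At most a + 1 parts means at most a parts, or exactly a + 1 parts, in which case deleting a
    column lowers the total by a + 1; this is [geo_rec] for k = a + 1. A bound on the number of
    parts thus turns into the factors with k <= a, as under conjugation. The weighted set [T]
    carries the rest of the configuration, so that the lemma can be iterated. *)
Lemma count_partitions (T : eqType) (B : pred T) (w : T -> nat) (f : nat -> nat) :
  (forall n, exists L : seq T, [/\ uniq L,
      forall y, (y \in L) = B y && (w y == n) & size L = f n]) ->
  forall a n, exists L : seq (seq nat * T), [/\ uniq L,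
      forall p, (p \in L) = [&& is_partition p.1, (size p.1 <= a)%N, B p.2 &
                             (sumn p.1 + w p.2 == n)%N] &
      size L = foldr (@geo nat) f (parts a) n].
Proof.
move=> fB; elim=> [|a IHa].
  move=> n; have [L [Lu LB Ls]] := fB n; exists [seq ([::], y) | y <- L]; split.
  - by rewrite map_inj_uniq// => x y [].
  - move=> [s y]; case: s => [|k s] /=.
      by rewrite -LB mem_map// => u v [].
    by rewrite andbF; apply/negP => /mapP[].
  - by rewrite size_map Ls.
elim/ltn_ind => n IHn; have [L [Lu LB Ls]] := IHa n.
case: (leqP a.+1 n) => an; last first.
  exists L; split => //.
  - move=> [s y]; rewrite LB /=; case sp: (is_partition s) => //=.
    rewrite [(size s <= a.+1)%N]leq_eqVlt ltnS; case: (size s =P a.+1) => //= sa.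
    rewrite sa ltnn /=; apply/esym/negbTE; rewrite negb_and -implybE.
    apply/implyP => _; apply/eqP => sn.
    have /(_ a.+1)[] := @add_column_partition _ (del_column s).
    + by rewrite -sa size_del_column.
    + exact: del_column_partition.
    by rewrite -sa del_columnK// => _ _; lia.
  - by rewrite Ls partsS /= [in RHS]geo_rec// leqNgt an/= addr0.
have [|L' [L'u L'B L's]] := IHn (n - a.+1)%N; first lia.
pose h (p : seq nat * T) := (add_column a.+1 p.1, p.2).
have L'P p : p \in L' -> is_partition p.1 /\ (size p.1 <= a.+1)%N.
  by rewrite L'B => /and4P[].
(* [L] gives the partitions with at most a parts, [map h L'] those with exactly a + 1. *)
exists (L ++ map h L'); split.
- rewrite cat_uniq Lu map_inj_in_uniq ?L'u ?andbT/=.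
    apply/hasPn => p /mapP[p' /L'P[p1 p2] ->]; rewrite LB /=.
    by have [_ -> _] := add_column_partition p2 p1; rewrite ltnn !andbF.
  move=> [s y] [s' y'] /L'P[/= + _] /L'P[/= + _] [].
  rewrite !is_partitionE => /andP[_ s0] /andP[_ s'0] ss' ->.
  by rewrite -(add_columnK a.+1 s0) ss' add_columnK.
- move=> [s y]; rewrite mem_cat LB /=; apply/orP/and4P.
    case=> [/and4P[-> sa -> ->]|/mapP[[s' y']]].
      by split => //; apply: leqW.
    rewrite L'B /= => /and4P[s'p s'a By' /eqP s'n] [-> ->].
    have [-> -> ->] := add_column_partition s'a s'p; split => //.
    by apply/eqP; lia.
  move=> [sp sa By sn]; case: (leqP (size s) a) => sa'.
    by left; apply/and4P.
  have {sa'}sa : size s = a.+1 by apply/eqP; rewrite eqn_leq sa.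
  right; apply/mapP; exists (del_column s, y); last first.
    by rewrite /h/= -sa del_columnK.
  have dp := del_column_partition sp; rewrite L'B /= dp By -sa size_del_column/=.
  have [_ _] := add_column_partition (size_del_column s) dp.
  rewrite del_columnK// => sE; move/eqP: sn; rewrite sE => <-.
  by apply/eqP; lia.
- rewrite size_cat size_map Ls L's [in RHS]partsS /= [in RHS]geo_rec// an.
  by rewrite partsS.
Qed.

(** [count_partitions] applied twice, once for each side, starting from a single configuration of
    weight 0. *)
Lemma card_concave_compositions (a b n : nat) :
  #|` fset_set (concave_compositions n `&`
       [set t | (size (lambda_minus t) <= a)%N /\
                (size (lambda_plus t) <= b)%N])| =
  gcount (parts a ++ parts b) n.
Proof.
have H0 m : exists L : seq unit, [/\ uniq L,
    forall y, (y \in L) = predT y && (0%N == m) & size L = (m == 0%N)].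
  by case: m => [|m]; [exists [:: tt]|exists [::]]; split => //; case.
have H1 := count_partitions H0 b.
have := @count_partitions _
  (fun p : seq nat * unit => is_partition p.1 && (size p.1 <= b)%N)
  (fun p => sumn p.1) (gcount (parts b)).
case/(_ _ a n) => [m|L [Lu LB Ls]].
  have [L [Lu LB Ls]] := H1 m; exists L; split => // p.
  by rewrite LB /= addn0 -andbA.
pose h (p : seq nat * (seq nat * unit)) : triple := (p.1, 0%N, p.2.1).
have hi : injective h by move=> [s [s' []]] [r [r' []]] [-> ->].
rewrite /gcount foldr_cat -/(gcount _) -Ls -(size_map h).
set A := _ `&` _.
have AE t : A t <-> t \in map h L.
  split.
    case: t => [[s c] s'] [/concave_compositionsP[/= sp s'p c0 sn] [/= sa s'b]].
    rewrite /central/= in c0; subst c.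
    apply/mapP; exists (s, (s', tt)) => //.
    by rewrite LB /=; apply/and4P; split=> //; [exact/andP|exact/eqP].
  move=> /mapP[[s [s' []]]]; rewrite LB /= => /and4P[sp sa /andP[s'p s'b] /eqP sn] ->.
  by split; [apply/concave_compositionsP|].
have Af : finite_set A.
  by apply: sub_finite_set (finite_concave_compositions n); exact: subIsetl.
have /perm_size <- // : perm_eq (enum_fset (fset_set A)) (map h L).
apply: uniq_perm; rewrite ?fset_uniq ?map_inj_uniq// => t.
have -> : (t \in enum_fset (fset_set A)) = (t \in fset_set A) by [].
rewrite in_fset_set//; apply/idP/idP; first by rewrite inE => /AE.
by move=> /AE tA; rewrite inE.
Qed.

(** A partition of total at most n has at most n parts, so the bounds a = b = n exclude nothing. *)
Lemma card_concave_compositions_all (n : nat) :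
  #|` fset_set (concave_compositions n)| = p2 n.
Proof.
rewrite /p2 -card_concave_compositions setIidl// => t.
move=> /concave_compositionsP[tm tp _ tn] /=.
have sz s : is_partition s -> (size s <= sumn s)%N.
  move=> /andP[_]; elim: s => //= k s IH /andP[k0 /IH ss].
  by rewrite -add1n leq_add.
by rewrite -tn; split; [apply: leq_trans (sz _ tm) (leq_addr _ _)|
  apply: leq_trans (sz _ tp) (leq_addl _ _)].
Qed.

(** * Shift operators and evaluation of generating functions *)

(** The coefficients read downwards from n, continued by 0 past m = n so that truncated subtraction
    never shows. *)
Definition rev_seq (V : nmodType) (f : nat -> V) (n m : nat) : V :=
  if (m <= n)%N then f (n - m)%N else 0.

Lemma geo_rev_seq (V : nmodType) k (f : nat -> V) n : (0 < k)%N ->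
  geo k f n = f n + rev_seq (geo k f) n k.
Proof. exact: geo_rec. Qed.

Lemma geo_rev_seqC (V : nmodType) k d (g : nat -> V) n : (0 < k)%N ->
  geo k (fun j => rev_seq g j d) n = rev_seq (geo k g) n d.
Proof.
move=> k0; rewrite /rev_seq; case: leqP => dn.
  rewrite (@geo_widen _ _ g _ n)// ?leq_subr// /geo.
  rewrite big_mkcond [RHS]big_mkcond; apply: eq_bigr => j _.
  case: leqP => jn; last by rewrite ifF//; lia.
  have -> : (d <= n - j * k)%N = (j * k <= n - d)%N by lia.
  by rewrite subnAC.
by rewrite /geo big1// => j jn; rewrite ifF//; lia.
Qed.

Lemma geo_natr (R : pzSemiRingType) k f n :
  (geo k f n)%:R = geo k (fun j => (f j)%:R : R) n.
Proof. exact: (big_morph (GRing.natmul 1) (natrD R) (mulr0n 1)). Qed.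

Section Operators.
Variable R : realType.
Implicit Types (u : nat -> R) (s : seq nat) (q r : R).

(* [prod_diff s] is the product over k in s of the operators 1 - T_k with
   (T_k u) m = u (m + k); on coefficients read backwards, T_k is
   multiplication by q^k. *)
Definition prod_diff s u : nat -> R :=
  foldl (fun v k m => v m - v (m + k)%N) u s.

(** By [geo_rec], 1 - T_k undoes the factor 1 / (1 - q^k). *)
Lemma prod_diff_gcount s1 s2 n : all (leq 1) s1 ->
  prod_diff s1 (fun m => (rev_seq (gcount (s1 ++ s2)) n m)%:R) =
  fun m => (rev_seq (gcount s2) n m)%:R.
Proof.
elim: s1 => //= k s1 IH /andP[k0 s10].
rewrite -(IH s10); congr foldl; apply/funext => m.
rewrite /rev_seq; case: (leqP m n) => mn; last first.
  by rewrite ifF ?subrr//; lia.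
rewrite geo_rev_seq// /rev_seq -subnDA.
have -> : (m + k <= n)%N = (k <= n - m)%N by lia.
by rewrite natrD addrK.
Qed.

(** The operator 1 - T_k multiplies the sequence q^m by 1 - q^k exactly, and an error bound
    proportional to r^m by 1 + r^k. The rate r may differ from q. *)
Lemma prod_diff_le s u (c q r eps : R) : 0 <= r ->
  (forall m, `|u m - c * q ^+ m| <= eps * r ^+ m) ->
  forall m, `|prod_diff s u m - c * (\prod_(k <- s) (1 - q ^+ k)) * q ^+ m| <=
            eps * (\prod_(k <- s) (1 + r ^+ k)) * r ^+ m.
Proof.
move=> r0; elim: s u c eps => [|k s IH] u c eps ucq m /=.
  by rewrite !big_nil !mulr1.
rewrite !big_cons ![_ * (_ * \prod_(i <- _) _)]mulrA; apply: IH => {}m.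
rewrite [X in `|X|](_ : _ = (u m - c * q ^+ m) - (u (m + k)%N - c * q ^+ (m + k))).
  apply: le_trans (ler_normB _ _) _.
  rewrite [leRHS](_ : _ = eps * r ^+ m + eps * r ^+ (m + k)) ?lerD//.
  by rewrite exprD; ring.
by rewrite exprD; ring.
Qed.

Lemma sum_shift q (g : nat -> R) k X :
  \sum_(n < X) rev_seq g n k * q ^+ n = q ^+ k * \sum_(n < X - k) g n * q ^+ n.
Proof.
elim: X => [|X IH]; first by rewrite sub0n !big_ord0 mulr0.
rewrite big_ord_recr /= IH /rev_seq; case: (leqP k X) => kX.
  rewrite subSn// big_ord_recr /= mulrDr; congr (_ + _).
  by rewrite mulrCA -exprD subnKC.
have -> : (X.+1 - k = X - k)%N by lia.
by rewrite mul0r addr0.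
Qed.

Lemma sum_shift_le q (g : nat -> R) k X : 0 <= q -> (forall n, 0 <= g n) ->
  \sum_(n < X) rev_seq g n k * q ^+ n <= q ^+ k * \sum_(n < X) g n * q ^+ n.
Proof.
move=> q0 g0; rewrite sum_shift ler_wpM2l ?exprn_ge0//.
rewrite -!(big_mkord xpredT (fun n => g n * q ^+ n)).
rewrite [leRHS](@big_cat_nat _ _ _ (X - k)%N) ?leq_subr//= lerDl.
by apply: sumr_ge0 => i _; rewrite mulr_ge0 ?exprn_ge0.
Qed.

Lemma geo_ge0 k (f : nat -> R) n : (forall n, 0 <= f n) -> 0 <= geo k f n.
Proof. by move=> f0; apply: sumr_ge0. Qed.

Lemma sum_geo_le q (f : nat -> R) k X : 0 <= q < 1 -> (0 < k)%N ->
  (forall n, 0 <= f n) ->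
  \sum_(n < X) geo k f n * q ^+ n <= (\sum_(n < X) f n * q ^+ n) / (1 - q ^+ k).
Proof.
move=> /andP[q0 q1] k0 f0.
rewrite ler_pdivlMr ?subr_gt0 ?exprn_ilt1 -?lt0n// mulrBr mulr1 lerBlDl.
have E : \sum_(n < X) geo k f n * q ^+ n = \sum_(n < X) f n * q ^+ n +
    \sum_(n < X) rev_seq (geo k f) n k * q ^+ n.
  by rewrite -big_split/=; apply: eq_bigr => n _; rewrite geo_rev_seq// mulrDl.
rewrite [leLHS]E [leLHS]addrC lerD2r [leRHS]mulrC.
by apply: sum_shift_le => // n; apply: geo_ge0.
Qed.

Definition gf s q : R := \prod_(k <- s) (1 - q ^+ k)^-1.

Lemma gf_cons k s q : gf (k :: s) q = (1 - q ^+ k)^-1 * gf s q.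
Proof. by rewrite /gf big_cons. Qed.

Lemma gf_cat s s' q : gf (s ++ s') q = gf s q * gf s' q.
Proof. by rewrite /gf big_cat. Qed.

Lemma gf_gt0 s q : 0 <= q < 1 -> all (leq 1) s -> 0 < gf s q.
Proof.
move=> /andP[q0 q1] /allP s0; rewrite /gf big_seq; apply: prodr_gt0 => k /s0 k0.
by rewrite invr_gt0 subr_gt0 exprn_ilt1// -lt0n.
Qed.

Lemma sum_gcount_le s q X : 0 <= q < 1 -> all (leq 1) s ->
  \sum_(n < X) (gcount s n)%:R * q ^+ n <= gf s q.
Proof.
move=> q01; elim: s => [_|k s IH /andP[k0 s0]].
  rewrite /gf big_nil; case: X => [|X]; first by rewrite big_ord0.
  by rewrite big_ord_recl /= big1 ?addr0 ?mulr1// => i _; rewrite mul0r.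
rewrite gf_cons mulrC.
under eq_bigr do rewrite geo_natr.
apply: (le_trans (sum_geo_le X q01 k0 _)) => //.
rewrite ler_wpM2r ?IH// invr_ge0 subr_ge0 exprn_ile1//; first by case/andP: q01.
by apply: ltW; case/andP: q01.
Qed.

Lemma gcount_le_gf s q n : 0 <= q < 1 -> all (leq 1) s ->
  (gcount s n)%:R * q ^+ n <= gf s q.
Proof.
move=> q01 s0; apply: le_trans (@sum_gcount_le s q n.+1 q01 s0).
rewrite big_ord_recr /= lerDr; apply: sumr_ge0 => i _.
by rewrite mulr_ge0 ?exprn_ge0//; case/andP: q01.
Qed.

(** The converse of [sum_gcount_le]: the series converges to the product. Inductively, its limit L
    for k :: s satisfies L = gf s q + q^k L. *)
Lemma gf_le s q U : 0 <= q < 1 -> all (leq 1) s ->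
  (forall X, \sum_(n < X) (gcount s n)%:R * q ^+ n <= U) -> gf s q <= U.
Proof.
move=> q01 s0 SU.
suff S_cvg : series (fun n => (gcount s n)%:R * q ^+ n) @ \oo --> gf s q.
  rewrite -(cvg_lim _ S_cvg)//.
  apply: limr_le; last by near=> X; rewrite /series/= big_mkord.
  apply: nondecreasing_is_cvgn.
    apply: nondecreasing_series => n _ _.
    by rewrite mulr_ge0 ?exprn_ge0//; case/andP: q01.
  by exists U => _ [X _ <-]; rewrite /series/= big_mkord.
elim: s s0 {U SU} => [_|k s IH /andP[k0 s0]].
  rewrite /gf big_nil; apply: cvg_near_cst; near=> X.
  rewrite /series/= big_mkord.
  have -> : X = X.-1.+1 by rewrite prednK//; near: X; exact: nbhs_infty_gt.
  by rewrite big_ord_recl /= big1 ?addr0 ?mulr1// => i _; rewrite mul0r.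
set S := series _.
have S_nd : nondecreasing_seq S.
  apply: nondecreasing_series => n _ _.
  by rewrite mulr_ge0 ?exprn_ge0//; case/andP: q01.
have /(nondecreasing_is_cvgn S_nd) S_cvg : has_ubound (range S).
  exists (gf (k :: s) q) => _ [X _ <-]; rewrite /S /series/= big_mkord.
  by apply: (@sum_gcount_le (k :: s)) => //=; rewrite k0.
(* Cutting at X + k makes the shifted series end exactly at X. *)
have SE X : S (X + k)%N = series (fun n => (gcount s n)%:R * q ^+ n) (X + k)%N +
    q ^+ k * S X.
  rewrite /S /series /= !big_mkord.
  have := sum_shift q (fun n => (geo k (gcount s) n)%:R) k (X + k).
  rewrite addnK => <-; rewrite -big_split/=.
  apply: eq_bigr => n _; rewrite geo_natr geo_rev_seq// mulrDl; congr (_ + _ * _).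
  by rewrite /rev_seq; case: ifP => //; rewrite geo_natr.
have lim1 : S (X + k)%N @[X --> \oo] --> limn S by rewrite (cvg_shiftn k).
have lim2 : S (X + k)%N @[X --> \oo] --> gf s q + q ^+ k * limn S.
  rewrite (_ : (fun X => S (X + k)%N) = (fun X =>
    series (fun n => (gcount s n)%:R * q ^+ n) (X + k)%N + q ^+ k * S X)).
    apply: cvgD; last exact: cvgMl_tmp.
    by rewrite (cvg_shiftn k); exact: IH.
  by apply/funext.
have H := cvg_unique _ lim1 lim2.
have q1 : 0 < 1 - q ^+ k.
  by rewrite subr_gt0 exprn_ilt1 -?lt0n//; case/andP: q01.
suff <- : limn S = gf (k :: s) q by [].
rewrite gf_cons; apply: (mulfI (lt0r_neq0 q1)); rewrite mulVKf ?lt0r_neq0//.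
by apply/eqP; rewrite mulrBl mul1r subr_eq; apply/eqP; exact: H.
Unshelve. all: by end_near. Qed.
End Operators.

(** * Tilted counts *)

Section MarkedCount.
Variable R : realType.
Implicit Types (I s : seq nat) (f : nat -> nat) (q x th : R).

(* Coefficient of q^n in the product over k in I of
   (1 + z (q^k + q^2k + ...)), times the generating function of f; the power
   of z counts the k in I that are used. *)
Fixpoint marked I f n : {poly R} :=
  if I is k :: I' then marked I' f n + 'X * rev_seq (geo k (marked I' f)) n k
  else (f n)%:R%:P.

Definition nneg_coefs (p : {poly R}) := forall i, 0 <= p`_i.

Lemma nneg_coefsD p p' : nneg_coefs p -> nneg_coefs p' -> nneg_coefs (p + p').
Proof. by move=> h h' i; rewrite coefD addr_ge0. Qed.

Lemma nneg_coefs_geo k (F : nat -> {poly R}) n :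
  (forall n, nneg_coefs (F n)) -> nneg_coefs (geo k F n).
Proof. by move=> F0 i; rewrite coef_sum sumr_ge0// => j _; apply: F0. Qed.

Lemma nneg_coefs_rev_seq (F : nat -> {poly R}) n k :
  (forall n, nneg_coefs (F n)) -> nneg_coefs (rev_seq F n k).
Proof. by move=> F0; rewrite /rev_seq; case: ifP => // _ i; rewrite coef0. Qed.

Lemma nneg_marked I f n : nneg_coefs (marked I f n).
Proof.
elim: I n => [|k I IH] n /=; first by move=> i; rewrite coefC; case: ifP.
apply: nneg_coefsD => // i; rewrite coefXM; case: ifP => // _.
by apply: nneg_coefs_rev_seq => {}n; apply: nneg_coefs_geo.
Qed.

Lemma nneg_horner (p : {poly R}) x : nneg_coefs p -> 0 <= x -> 0 <= p.[x].
Proof.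
by move=> p0 x0; rewrite horner_coef sumr_ge0// => i _; rewrite mulr_ge0 ?exprn_ge0.
Qed.

Lemma horner_geo k (F : nat -> {poly R}) n x :
  (geo k F n).[x] = geo k (fun j => (F j).[x]) n.
Proof. by rewrite /geo horner_sum. Qed.

Lemma horner_rev_seq (F : nat -> {poly R}) n k x :
  (rev_seq F n k).[x] = rev_seq (fun j => (F j).[x]) n k.
Proof. by rewrite /rev_seq; case: ifP => // _; rewrite horner0. Qed.

Lemma eq_rev_seq (V : nmodType) (f g : nat -> V) n k :
  f =1 g -> rev_seq f n k = rev_seq g n k.
Proof. by move=> fg; rewrite /rev_seq; case: ifP. Qed.

Lemma rev_seq_natr f n k :
  (rev_seq f n k)%:R = rev_seq (fun j => (f j)%:R : R) n k.
Proof. by rewrite /rev_seq; case: ifP. Qed.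

Lemma marked1 I s n : all (leq 1) I ->
  (marked I (gcount s) n).[1] = (gcount (I ++ s) n)%:R.
Proof.
elim: I n => [|k I IH] n /=; first by rewrite hornerC.
move=> /andP[k0 I0]; rewrite hornerD hornerM hornerX mul1r IH// horner_rev_seq.
rewrite geo_natr geo_rev_seq//; congr (_ + _).
by apply: eq_rev_seq => m; rewrite horner_geo; apply: eq_geo => j; rewrite IH.
Qed.

Lemma deriv_geo k (F : nat -> {poly R}) n :
  (geo k F n)^`() = geo k (fun j => (F j)^`()) n.
Proof. exact: (raddf_sum (@deriv R)). Qed.

Lemma deriv_rev_seq (F : nat -> {poly R}) n k :
  (rev_seq F n k)^`() = rev_seq (fun j => (F j)^`()) n k.
Proof. by rewrite /rev_seq; case: ifP => // _; rewrite deriv0. Qed.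

(** Differentiating at 1 weighs each configuration by the number of d in I that it uses; removing
    one copy of d matches those using d with all configurations of weight n - d. *)
Lemma deriv_marked1 I s n : all (leq 1) I ->
  (marked I (gcount s) n)^`().[1] =
  \sum_(d <- I) (rev_seq (gcount (I ++ s)) n d)%:R.
Proof.
elim: I n => [|k I IH] n /=; first by rewrite derivC horner0 big_nil.
move=> /andP[k0 I0].
rewrite derivD derivM derivX mul1r !hornerD hornerM hornerX mul1r IH// big_cons.
rewrite addrCA; congr (_ + _).
  rewrite horner_rev_seq rev_seq_natr; apply: eq_rev_seq => m.
  rewrite horner_geo geo_natr; apply: eq_geo => j; exact: marked1.
rewrite deriv_rev_seq horner_rev_seq.
transitivity (geo k (fun j => \sum_(d <- I) (rev_seq (gcount (I ++ s)) j d)%:R : R) n).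
  rewrite geo_rev_seq//; congr (_ + _); apply: eq_rev_seq => m.
  by rewrite deriv_geo horner_geo; apply: eq_geo => j; rewrite IH.
rewrite {1}/geo exchange_big/=; apply: eq_bigr => d _.
rewrite -[X in X%:R](geo_rev_seqC d (gcount (I ++ s)) n k0) geo_natr.
exact: eq_bigr.
Qed.

(** Each marked factor is 1 + x q^k / (1 - q^k) = (1 + (x - 1) q^k) / (1 - q^k); as in
    [sum_gcount_le], partial sums suffice. *)
Lemma sum_marked_le I s q x X : 0 <= q < 1 -> 0 <= x ->
  all (leq 1) I -> all (leq 1) s ->
  \sum_(n < X) (marked I (gcount s) n).[x] * q ^+ n <=
  \prod_(d <- I) (1 + (x - 1) * q ^+ d) * gf (I ++ s) q.
Proof.
move=> q01 x0; have /andP[q0 q1] := q01; elim: I X => [|k I IH] X /=.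
  rewrite big_nil mul1r => _ s0; under eq_bigr do rewrite hornerC.
  exact: sum_gcount_le.
move=> /andP[k0 I0] s0.
have qk : 0 < 1 - q ^+ k by rewrite subr_gt0 exprn_ilt1// -lt0n.
have F0 n : 0 <= (marked I (gcount s) n).[x].
  by apply: nneg_horner x0; exact: nneg_marked.
under eq_bigr => n _ do rewrite hornerD hornerM hornerX mulrDl -mulrA horner_rev_seq
  (eq_rev_seq _ _ (fun m => horner_geo k (marked I (gcount s)) m x)).
rewrite big_split/= -mulr_sumr big_cons gf_cons.
set S := \sum_(n < X) (marked _ _ _).[x] * _.
set S' := \sum_(n < X) rev_seq _ _ _ * _.
have S'le : S' <= q ^+ k * (S / (1 - q ^+ k)).
  apply: (le_trans (sum_shift_le _ _ q0 _)) => [n|]; first exact: geo_ge0.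
  by rewrite ler_wpM2l ?exprn_ge0//; exact: sum_geo_le.
have {}IH : S <= _ := IH X I0 s0.
apply: (@le_trans _ _ (S * ((1 + (x - 1) * q ^+ k) * (1 - q ^+ k)^-1))).
  apply: le_trans (lerD (lexx S) (ler_wpM2l x0 S'le)) _.
  by rewrite le_eqVlt; apply/orP; left; apply/eqP; field; rewrite lt0r_neq0.
apply: le_trans (ler_wpM2r _ IH) _.
  rewrite mulr_ge0 ?invr_ge0 ?(ltW qk)//.
  by have := mulr_ge0 x0 (exprn_ge0 k q0); lra.
by rewrite le_eqVlt; apply/orP; left; apply/eqP; ring.
Qed.

(** Jensen's inequality for exp: the coefficients act as weights on the exponents i, and m is their
    mean. *)
Lemma jensen_horner (p : {poly R}) th m : nneg_coefs p ->
  p^`().[1] = m * p.[1] -> p.[1] * expR (th * m) <= p.[expR th].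
Proof.
move=> p0 pm.
have E : \sum_(i < size p) p`_i * i%:R = m * p.[1].
  rewrite -pm -[in RHS](coefK p) poly_def raddf_sum horner_sum; apply: eq_bigr => i _.
  by rewrite /= derivZ derivXn hornerZ hornerMn hornerXn expr1n.
(* The tangent to exp at th m, whose linear term averages to zero. *)
have -> : p.[1] * expR (th * m) = \sum_(i < size p)
    p`_i * (expR (th * m) * (1 + th * (i%:R - m))).
  transitivity (expR (th * m) * (p.[1] + th * (m * p.[1] - m * p.[1]))).
    by rewrite subrr mulr0 addr0 mulrC.
  rewrite -{1}E horner_coef [m * _]mulrC mulr_suml -sumrB mulr_sumr -big_split.
  rewrite mulr_sumr; apply: eq_bigr => i _ /=; rewrite expr1n; ring.
rewrite horner_coef; apply: ler_sum => i _; rewrite ler_wpM2l//.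
rewrite -expRM_natl (_ : _ * th = th * m + th * (i%:R - m)); last ring.
by rewrite expRD ler_wpM2l ?expR_ge0 ?expR_ge1Dx.
Qed.

(* Convexity of the cumulant generating function of the number of k in I that
   occur in a uniformly random configuration of weight n, compared with its
   value in the product (Boltzmann) measure. *)
Lemma gcount_tilt I s q th m n : 0 <= q < 1 -> all (leq 1) I -> all (leq 1) s ->
  \sum_(d <- I) (rev_seq (gcount (I ++ s)) n d)%:R = m * (gcount (I ++ s) n)%:R ->
  (gcount (I ++ s) n)%:R * expR (th * m) * q ^+ n <=
  expR ((expR th - 1) * \sum_(d <- I) q ^+ d) * gf (I ++ s) q.
Proof.
move=> q01 I0 s0 mE; have /andP[q0 q1] := q01.
have Is0 : all (leq 1) (I ++ s) by rewrite all_cat I0.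
have x0 := expR_ge0 th.
apply: (@le_trans _ _ (\prod_(d <- I) (1 + (expR th - 1) * q ^+ d) * gf (I ++ s) q)).
  apply: (@le_trans _ _ ((marked I (gcount s) n).[expR th] * q ^+ n)).
    rewrite ler_wpM2r ?exprn_ge0// -marked1//; apply: jensen_horner.
      exact: nneg_marked.
    by rewrite deriv_marked1// marked1.
  apply: le_trans (sum_marked_le n.+1 q01 x0 I0 s0).
  rewrite big_ord_recr /= lerDr; apply: sumr_ge0 => i _.
  by rewrite mulr_ge0 ?exprn_ge0// nneg_horner//; exact: nneg_marked.
rewrite ler_wpM2r ?(ltW (gf_gt0 q01 Is0))// mulr_sumr expR_sum.
rewrite big_seq [leRHS]big_seq; apply: ler_prod => d dI; rewrite expR_ge1Dx andbT.
have := exprn_ge0 d q0; have := exprn_ile1 d q0 (ltW q1) => h1 h2.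
by have := mulr_ge0 x0 h2; lra.
Qed.
End MarkedCount.

(** * The value of zeta(2) *)

Section Basel.
Variable R : realType.
Implicit Types x : R.

Lemma derivative_MVT (f df : R -> R) x : 0 < x ->
  (forall y, 0 <= y <= x -> is_derive y 1 f (df y)) ->
  exists2 y, 0 < y < x & f x = f 0 + df y * x.
Proof.
move=> x0 fd; have [||y yx fE] := @MVT R f df 0 x x0.
- by move=> y; rewrite in_itv/= => /andP[y0 yx]; apply: fd; rewrite !ltW.
- apply: derivable_within_continuous => y; rewrite in_itv/= => /fd fdy.
  exact: ex_derive.
- exists y; first by move: yx; rewrite in_itv.
  by move: fE; rewrite subr0 => <-; rewrite addrC subrK.
Qed.

Lemma sin_le_id x : 0 < x -> sin x <= x.
Proof.
move=> x0; have [y _ ->] := derivative_MVT x0 (fun y _ => is_derive_sin y).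
by rewrite sin0 add0r ler_piMl ?(ltW x0)// cos_le1.
Qed.

Lemma id_le_tan x : 0 < x < pi / 2 -> x <= tan x.
Proof.
move=> /andP[x0 xpi].
have cos0 y : 0 <= y <= x -> 0 < cos y.
  move=> /andP[y0 yx]; apply: cos_gt0_pihalf; apply/andP; split.
    by rewrite (lt_le_trans _ y0)// oppr_lt0 divr_gt0// pi_gt0.
  exact: le_lt_trans xpi.
have [|y yx ->] := @derivative_MVT tan (fun y => (cos y) ^-2) x x0.
  by move=> y /cos0 cy; apply: is_derive_tan; rewrite gt_eqF.
have cy : 0 < cos y by apply: cos0; case/andP: yx => *; rewrite !ltW.
rewrite tan0 add0r ler_peMl ?(ltW x0)// invr_ge1.
- by rewrite exprn_ile1 ?(ltW cy) ?cos_le1.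
- by rewrite unitfE expf_neq0 ?gt_eqF.
- by rewrite exprn_gt0.
Qed.

(** From sin x <= x <= tan x, since 1 / sin^2 x = 1 + 1 / tan^2 x. *)
Lemma csc2_bounds x : 0 < x < pi / 2 -> x ^-2 <= (sin x) ^-2 <= 1 + x ^-2.
Proof.
move=> x0pi; have /andP[x0 xpi] := x0pi.
have s0 : 0 < sin x by exact: sin_gt0_pihalf.
have c0 : 0 < cos x.
  by apply: cos_gt0_pihalf; rewrite xpi andbT (lt_trans _ x0)// oppr_lt0 divr_gt0 ?pi_gt0.
apply/andP; split.
  rewrite lef_pV2 ?posrE ?exprn_gt0// lerXn2r ?nnegrE ?(ltW s0) ?(ltW x0)//.
  exact: sin_le_id.
have -> : (sin x) ^-2 = 1 + (tan x) ^-2.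
  have -> : (tan x) ^-2 = cos x ^+ 2 / sin x ^+ 2.
    by rewrite /tan; field; rewrite !gt_eqF.
  by rewrite cos2sin2; field; rewrite gt_eqF.
rewrite lerD2l lef_pV2 ?posrE ?exprn_gt0 ?divr_gt0//.
by rewrite lerXn2r ?nnegrE ?(ltW x0) ?divr_ge0 ?(ltW s0) ?(ltW c0)// id_le_tan.
Qed.

(** The midpoint of the k-th of M equal pieces of the interval from 0 to pi / 2. *)
Definition angle (M k : nat) : R := (2 * k%:R + 1) * pi / (4 * M%:R).

(* csc^2 x = (csc^2 (x/2) + csc^2 (pi/2 - x/2)) / 4 *)
Lemma sum_csc2 n :
  \sum_(k < 2 ^ n) (sin (angle (2 ^ n) k)) ^-2 = 2 * 4 ^+ n.
Proof.
elim: n => [|n IH].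
  rewrite big_ord1 (_ : angle _ _ = pi / 4); last first.
    by rewrite /angle mulr0 add0r mul1r mulr1.
  have := @tan_piquarter R; rewrite /tan.
  have := cos2Dsin2 (pi / 4 : R).
  have c0 : 0 < cos (pi / 4 : R).
    by apply: cos_gt0_pihalf; have := pi_gt0 R => pi0; apply/andP; split; lra.
  move=> cs tE.
  have sc : sin (pi / 4 : R) = cos (pi / 4).
    by rewrite -[LHS](divfK (lt0r_neq0 c0)) tE mul1r.
  have {cs} : sin (pi / 4 : R) ^+ 2 = 2^-1 by rewrite sc in cs *; lra.
  by move=> ->; rewrite invrK expr0 mulr1.
have pi0 := pi_gt0 R.
have M0 : 0 < (2 ^ n)%:R :> R by rewrite ltr0n expn_gt0.
rewrite exprS mulrCA -IH mulr_sumr.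
rewrite -(big_mkord xpredT (fun k => (sin (angle (2 ^ n.+1) k)) ^-2)).
rewrite -(big_mkord xpredT (fun k => 4 * (sin (angle (2 ^ n) k)) ^-2)).
have le2 : (2 ^ n <= 2 ^ n.+1)%N by rewrite expnS; lia.
rewrite (@big_cat_nat _ _ _ (2 ^ n))//= -[X in _ + \big[_/_]_(X <= _ < _) _]add0n big_addn.
have -> : (2 ^ n.+1 - 2 ^ n = 2 ^ n)%N by rewrite expnS; lia.
(* Reversing the upper half pairs each angle y with pi / 2 - y. *)
rewrite [X in _ + X]big_nat_rev -big_split/=.
rewrite !big_mkord; apply: eq_bigr => k _; rewrite add0n.
set y := angle (2 ^ n.+1) k.
have -> : angle (2 ^ n) k = y *+ 2.
  by rewrite /y /angle expnS natrM -mulr_natl; field; rewrite gt_eqF.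
have -> : angle (2 ^ n.+1) (2 ^ n - k.+1 + 2 ^ n) = pi / 2 - y.
  rewrite /y /angle (_ : (_ + _)%:R = 2 * (2 ^ n)%:R - k%:R - 1); last first.
    have kn := ltn_ord k.
    by rewrite natrD natrB// -[k.+1%:R]natr1; ring.
  by rewrite expnS natrM; field; rewrite gt_eqF.
have y0 : 0 < y < pi / 2.
  rewrite /y /angle expnS natrM; apply/andP; split.
    by rewrite divr_gt0 ?mulr_gt0// ltr_wpDl// mulr_ge0 ?ler0n.
  have kn : k%:R + 1 <= (2 ^ n)%:R :> R by rewrite natr1 ler_nat.
  rewrite ltr_pdivrMr; last by rewrite !mulr_gt0.
  rewrite [ltRHS](_ : _ = (4 * (2 ^ n)%:R) * pi); last by field.
  by rewrite ltr_pM2r//; lra.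
have s0 : 0 < sin y by exact: sin_gt0_pihalf.
have c0 : 0 < cos y.
  by apply: cos_gt0_pihalf; case/andP: y0 => y0 ->; rewrite andbT; lra.
rewrite sin_mulr2n sinB sin_pihalf cos_pihalf mul1r mul0r subr0 -mulr_natl.
have -> : (sin y) ^-2 + (cos y) ^-2 = ((cos y) ^+ 2 + (sin y) ^+ 2) / (sin y * cos y) ^+ 2.
  by field; rewrite !gt_eqF.
by rewrite cos2Dsin2; field; rewrite !gt_eqF.
Qed.

Definition zeta2 (J : nat) : R := \sum_(j < J) (j.+1%:R ^+ 2)^-1.

Definition odd_zeta2 (J : nat) : R := \sum_(j < J) ((2 * j%:R + 1) ^+ 2)^-1.

Lemma zeta2_double M : zeta2 (2 * M) = odd_zeta2 M + zeta2 M / 4.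
Proof.
elim: M => [|M IH]; first by rewrite muln0 /zeta2 /odd_zeta2 !big_ord0 mul0r addr0.
have -> : (2 * M.+1 = (2 * M).+2)%N by lia.
rewrite /zeta2 !big_ord_recr /= -/(zeta2 _) IH /odd_zeta2 big_ord_recr /=.
rewrite -/(zeta2 M) -/(odd_zeta2 M).
have -> : (2 * M).+1%:R = 2 * M%:R + 1 :> R by rewrite -natr1 natrM.
have -> : (2 * M).+2%:R = 2 * M.+1%:R :> R by rewrite -natrM; congr (_%:R); lia.
have -> : ((2 * M.+1%:R) ^+ 2)^-1 = (M.+1%:R ^+ 2)^-1 / 4 :> R.
  by field; rewrite nat1r pnatr_eq0.
ring.
Qed.

(** [csc2_bounds] is summed over the 2^n angles, whose inverse squares are multiples of 1 / (2 k +
    1)^2; the 1 in the upper bound costs 2^n in all, against a sum of 2 * 4^n. *)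
Lemma odd_zeta2_bounds n :
  pi ^+ 2 / 8 - pi ^+ 2 / (16 * 2 ^+ n) <= odd_zeta2 (2 ^ n) <= pi ^+ 2 / 8.
Proof.
have pi0 := pi_gt0 R.
have M0 : 0 < 2 ^+ n :> R by rewrite exprn_gt0.
have Mn : (2 ^ n)%:R = 2 ^+ n :> R by rewrite natrX.
have aE k : (angle (2 ^ n) k) ^-2 =
    16 * (2 ^+ n) ^+ 2 / pi ^+ 2 * ((2 * k%:R + 1) ^+ 2)^-1.
  have k0 : 0 < 2 * k%:R + 1 :> R by rewrite ltr_wpDl// mulr_ge0 ?ler0n.
  by rewrite /angle Mn; move: (pi : R) pi0 => p p0; field; rewrite !gt_eqF.
have a0 (k : 'I_(2 ^ n)) : 0 < angle (2 ^ n) k < pi / 2.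
  have kn : k%:R + 1 <= 2 ^+ n :> R by rewrite -Mn natr1 ler_nat.
  rewrite /angle Mn; apply/andP; split.
    by rewrite divr_gt0 ?mulr_gt0// ltr_wpDl// mulr_ge0 ?ler0n.
  rewrite ltr_pdivrMr; last by rewrite !mulr_gt0.
  rewrite [ltRHS](_ : _ = (2 * 2 ^+ n) * pi); last by field.
  by rewrite ltr_pM2r//; lra.
have E : 2 * (2 ^+ n) ^+ 2 = \sum_(k < 2 ^ n) (sin (angle (2 ^ n) k)) ^-2 :> R.
  by rewrite sum_csc2 -exprM mulnC exprM -natrX.
have lo : 16 * (2 ^+ n) ^+ 2 / pi ^+ 2 * odd_zeta2 (2 ^ n) <= 2 * (2 ^+ n) ^+ 2.
  rewrite E mulr_sumr; apply: ler_sum => k _; rewrite -aE.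
  by case/andP: (csc2_bounds (a0 k)).
have up : 2 * (2 ^+ n) ^+ 2 <=
    2 ^+ n + 16 * (2 ^+ n) ^+ 2 / pi ^+ 2 * odd_zeta2 (2 ^ n).
  have ME : 2 ^+ n = \sum_(k < 2 ^ n) 1 :> R by rewrite sumr_const card_ord Mn.
  rewrite E [X in X + _]ME mulr_sumr -big_split/=; apply: ler_sum => k _.
  by rewrite -aE; case/andP: (csc2_bounds (a0 k)).
clear aE a0 E; move: (2 ^+ n) (odd_zeta2 _) (pi : R) pi0 M0 lo up {Mn}.
move=> M O p p0 M0 lo up.
have K0 : 0 < p ^+ 2 / (16 * M ^+ 2).
  by rewrite divr_gt0 ?mulr_gt0 ?exprn_gt0.
have /(ler_wpM2l (ltW K0)) := lo; have /(ler_wpM2l (ltW K0)) := up.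
rewrite (_ : _ * (M + _) = p ^+ 2 / (16 * M) + O); last first.
  by field; rewrite !gt_eqF.
rewrite (_ : _ * (2 * M ^+ 2) = p ^+ 2 / 8); last by field; rewrite !gt_eqF.
rewrite (_ : _ * (_ / p ^+ 2 * O) = O); last by field; rewrite !gt_eqF.
by lra.
Qed.

(** pi^2 / 6 is fixed by the map s -> pi^2 / 8 + s / 4 that [zeta2_double] approximates, and the
    error bound reproduces itself since 1/16 + 1/16 = 1/8. *)
Lemma zeta2_dyadic n : `|zeta2 (2 ^ n) - pi ^+ 2 / 6| <= pi ^+ 2 / 4 / 2 ^+ n.
Proof.
have pi2 := pi_ge2 R; have pi0 := pi_gt0 R.
have pipi : 4 <= pi ^+ 2 :> R by rewrite expr2; nra.
elim: n => [|n IH].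
  rewrite /zeta2 big_ord1 expr1n invr1 mulr1 ler_norml.
  by apply/andP; split; lra.
have /andP[lo hi] := odd_zeta2_bounds n.
rewrite expnS zeta2_double [2 ^+ n.+1]exprS.
move: IH; rewrite !ler_norml => /andP[h1 h2].
have N0 : 2 ^+ n != 0 :> R by rewrite expf_neq0 ?pnatr_eq0.
have D1 (P N : R) : N != 0 -> P / (16 * N) = P / N / 16 by move=> ?; field.
have D2 (P N : R) : N != 0 -> P / 4 / (2 * N) = P / N / 8 by move=> ?; field.
rewrite D1// in lo; rewrite D2//; rewrite [_ / 4 / _]mulrAC in h1 h2.
have : 0 <= pi ^+ 2 / 2 ^+ n :> R by rewrite divr_ge0 ?exprn_ge0 ?ltW.
by move=> e0; apply/andP; split; lra.
Qed.

(** Telescoping with 1 / (m + 1)^2 <= 1 / m - 1 / (m + 1) compares J with large powers of 2, where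
    [zeta2_dyadic] applies. *)
Lemma zeta2_bounds J : (0 < J)%N ->
  pi ^+ 2 / 6 - J%:R^-1 <= zeta2 J <= pi ^+ 2 / 6.
Proof.
move=> J0.
have zeta2_le K : (J <= K)%N -> zeta2 J <= zeta2 K <= zeta2 J + J%:R^-1 - K%:R^-1.
  move=> JK; rewrite -(subnKC JK); elim: (K - J)%N => [|d /andP[IH1 IH2]].
    by rewrite addn0 lexx addrK /=.
  rewrite addnS /zeta2 big_ord_recr /= -/(zeta2 J) -/(zeta2 (J + d)).
  set m := (J + d)%N in IH1 IH2 *.
  have m0 : 0 < m%:R :> R by rewrite ltr0n /m; lia.
  rewrite -natr1; apply/andP; split.
    by rewrite ler_wpDr// invr_ge0 sqr_ge0.
  suff : ((m%:R + 1) ^+ 2)^-1 <= m%:R^-1 - (m%:R + 1)^-1 :> R by lra.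
  rewrite (_ : _ - _ = (m%:R * (m%:R + 1))^-1); last first.
    by field; rewrite !gt_eqF// ltr_wpDl// ltW.
  rewrite lef_pV2 ?posrE ?exprn_gt0 ?mulr_gt0 ?addr_gt0//.
  by rewrite expr2 ler_wpM2r; lra.
have C n : (J <= 2 ^ n)%N -> zeta2 J <= pi ^+ 2 / 6 + pi ^+ 2 / 4 / 2 ^+ n /\
    pi ^+ 2 / 6 <= zeta2 J + J%:R^-1 + pi ^+ 2 / 4 / 2 ^+ n.
  move=> /zeta2_le/andP[z1 z2]; have := zeta2_dyadic n.
  have : 0 <= (2 ^ n)%:R^-1 :> R by rewrite invr_ge0 ler0n.
  by rewrite ler_norml => n0 /andP[d1 d2]; split; lra.
have D (e : R) : 0 < e -> exists2 n, (J <= 2 ^ n)%N & pi ^+ 2 / 4 / 2 ^+ n <= e.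
  move=> e0; pose n := maxn J (Num.truncn (pi ^+ 2 / 4 / e)).+1.
  have n2 : (n <= 2 ^ n)%N by apply/ltnW/ltn_expl.
  exists n; first exact: leq_trans (leq_maxl _ _) n2.
  rewrite ler_pdivrMr ?exprn_gt0// [e * _]mulrC -ler_pdivrMr//.
  apply: (@le_trans _ _ n%:R); last by rewrite -natrX ler_nat.
  apply: ltW; apply: lt_le_trans (truncnS_gt _) _.
  by rewrite ler_nat leq_maxr.
apply/andP; split.
  rewrite lerBlDr; apply/ler_addgt0Pr => e /D[n /C[_ c] d].
  by apply: le_trans c _; rewrite lerD2l.
apply/ler_addgt0Pr => e /D[n /C[c _] d].
by apply: le_trans c _; rewrite lerD2l.
Qed.
End Basel.

(** * Size of the generating function near q = 1 *)

Section GeneratingFunctionBounds.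
Variable R : realType.
Implicit Types (t x y q : R) (N J : nat).

Lemma sum_parts (F : nat -> R) N : \sum_(d <- parts N) F d = \sum_(d < N) F d.+1.
Proof.
elim: N => [|N IH]; first by rewrite big_nil big_ord0.
by rewrite partsS big_cons IH big_ord_recr addrC.
Qed.

Lemma sum_geom y N : y != 1 -> \sum_(d < N) y ^+ d.+1 = y * (1 - y ^+ N) / (1 - y).
Proof.
rewrite eq_sym -subr_eq0 => y1; elim: N => [|N IH].
  by rewrite big_ord0 expr0 subrr mulr0 mul0r.
by rewrite big_ord_recr /= IH exprS; field.
Qed.

(** The difference of - ln (1 - y) and its Taylor polynomial has derivative y^J / (1 - y), to which
    the mean value theorem applies. *)
Lemma ln_series x J : 0 < x < 1 ->
  \sum_(j < J) x ^+ j.+1 / j.+1%:R <= - ln (1 - x) <=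
  \sum_(j < J) x ^+ j.+1 / j.+1%:R + x ^+ J.+1 / (1 - x).
Proof.
move=> /andP[x0 x1].
pose p : {poly R} := \sum_(j < J) j.+1%:R^-1 *: 'X^(j.+1).
have pE y : p.[y] = \sum_(j < J) y ^+ j.+1 / j.+1%:R.
  by rewrite horner_sum; apply: eq_bigr => j _; rewrite hornerZ hornerXn mulrC.
have dpE y : p^`().[y] = \sum_(j < J) y ^+ j.
  rewrite /p raddf_sum horner_sum; apply: eq_bigr => j _ /=.
  rewrite derivZ derivXn hornerZ hornerMn hornerXn -[y ^+ _ *+ _]mulr_natl.
  by rewrite mulKf ?pnatr_eq0.
pose f y := - ln (1 - y) - p.[y].
have df y : 0 <= y <= x -> is_derive y 1 f (y ^+ J / (1 - y)).
  move=> /andP[y0 yx].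
  have y1 : 0 < 1 - y by lra.
  have dln : is_derive y 1 (fun z => ln (1 - z)) (- (1 - y)^-1).
    have -> : (fun z => ln (1 - z)) = (@ln R) \o (fun z => 1 - z) by [].
    have h1 := is_derive1_ln y1.
    have h2 : is_derive y 1 (fun z : R => 1 - z) (- 1).
      have := is_deriveB (is_derive_cst (1 : R) y (1 : R)) (is_derive_id y (1 : R)).
      by rewrite sub0r.
    by have := @is_derive1_comp _ (@ln R) (fun z => 1 - z) _ _ _ h1 h2; rewrite mulrN1.
  suff -> : y ^+ J / (1 - y) = - - (1 - y)^-1 - p^`().[y].
    exact: (is_deriveB (is_deriveN dln) (is_derive_poly p y)).
  have yJ : y ^+ J = 1 - (1 - y) * \sum_(j < J) y ^+ j.
    by rewrite -[LHS](subrK 1) subrX1; ring.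
  by rewrite opprK dpE yJ; field; rewrite gt_eqF.
have [y /andP[y0 yx] fx] := derivative_MVT x0 df.
have p0 : p.[0] = 0.
  by rewrite pE big1// => j _; rewrite expr0n mul0r.
rewrite /f subr0 ln1 p0 oppr0 !add0r pE in fx.
have xJ : 0 <= y ^+ J / (1 - y) * x <= x ^+ J.+1 / (1 - x).
  have y1 : 0 < 1 - y by lra.
  have hJ : y ^+ J <= x ^+ J by rewrite lerXn2r ?nnegrE ?ltW.
  have yJ : 0 <= y ^+ J by rewrite exprn_ge0 ?ltW.
  apply/andP; split; first by rewrite mulr_ge0 ?(ltW x0)// divr_ge0// ltW.
  rewrite exprSr mulrAC ler_pM ?mulr_ge0 ?invr_ge0 ?ler_wpM2r ?(ltW x0) ?(ltW y1)//.
  by rewrite lef_pV2 ?posrE ?subr_gt0//; lra.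
by case/andP: xJ => h1 h2; apply/andP; split; lra.
Qed.

Lemma expRN_le x : 0 < x -> expR (- x) <= x^-1.
Proof.
move=> x0; rewrite expRN lef_pV2 ?posrE ?expR_gt0//.
by have := expR_ge1Dx x; lra.
Qed.

(* y / (1 - y) = 1 / (e^x - 1) for y = e^(-x) *)
Lemma expRN_odds_bounds x : 0 < x ->
  x^-1 - 1 <= expR (- x) / (1 - expR (- x)) <= x^-1.
Proof.
move=> x0; have y1 : 0 < 1 - expR (- x) by rewrite subr_gt0 expR_lt1 oppr_lt0.
have e1 := expR_ge1Dx (- x); have e2 := expR_ge1Dx x.
have e3 : expR x * expR (- x) = 1 by rewrite expRxMexpNx_1.
have e0 := expR_gt0 (- x).
apply/andP; split.
  by rewrite ler_pdivlMr// -(ler_pM2l x0) [leLHS](_ : _ = (1 - x) * (1 - expR (- x))); [nra|field; rewrite gt_eqF].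
by rewrite ler_pdivrMr// -(ler_pM2l x0) mulVKf ?gt_eqF//; nra.
Qed.

(** The constant c with c^2 = 2 zeta(2): the logarithm of G(e^(-t)) is about c^2 / t, and c^2 / t +
    t n is least at t = c / sqrt n, with value 2 c sqrt n. *)
Definition saddle : R := pi / Num.sqrt 3.

Lemma saddle_sqr : saddle ^+ 2 = pi ^+ 2 / 3.
Proof. by rewrite /saddle expr_div_n sqr_sqrtr. Qed.

Lemma expR_powM t d j : expR (- t) ^+ d ^+ j = expR (- (j%:R * t)) ^+ d.
Proof. by rewrite exprAC -(expRM_natl j) mulrN. Qed.

(** Expanding the logarithm and exchanging the sums gives the sum over j of 1 / j times a geometric
    sum at most 1 / (j t), hence zeta(2) / t. The expansion is cut at J, with a remainder that
    vanishes as J grows. *)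
Lemma sum_ln_le t N : 0 < t ->
  \sum_(d < N) - ln (1 - expR (- t) ^+ d.+1) <= pi ^+ 2 / 6 / t.
Proof.
move=> t0; set q := expR (- t).
have q0 : 0 < q := expR_gt0 _.
have q1 : q < 1 by rewrite /q expR_lt1 oppr_lt0.
have q1' : 0 < 1 - q by lra.
have qd d : 0 < q ^+ d.+1 <= q.
  by rewrite exprn_gt0//= exprS ger_pMr// exprn_ile1 ?ltW.
have H J : \sum_(d < N) - ln (1 - q ^+ d.+1) <=
    pi ^+ 2 / 6 / t + N%:R * (q ^+ J.+1 / (1 - q)).
  apply: (@le_trans _ _ (\sum_(d < N) (\sum_(j < J) (q ^+ d.+1) ^+ j.+1 / j.+1%:R
      + q ^+ J.+1 / (1 - q)))).
    apply: ler_sum => d _; have /andP[d0 d1] := qd d.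
    have /(ln_series J)/andP[_ h] : 0 < q ^+ d.+1 < 1 by rewrite d0 (le_lt_trans d1).
    apply: le_trans h _; rewrite lerD2l; apply: ler_pM.
    - by rewrite exprn_ge0// ltW.
    - by rewrite invr_ge0; lra.
    - by rewrite lerXn2r ?nnegrE ?(ltW d0) ?(ltW q0).
    - by rewrite lef_pV2 ?posrE; lra.
  rewrite big_split/= sumr_const card_ord -[X in _ + X]mulr_natl lerD2r.
  rewrite exchange_big/=.
  apply: (@le_trans _ _ (zeta2 R J / t)); last first.
    case: J => [|J]; first by rewrite /zeta2 big_ord0 mul0r !divr_ge0 ?sqr_ge0 ?(ltW t0).
    rewrite ler_wpM2r ?invr_ge0 ?(ltW t0)//.
    by case/andP: (@zeta2_bounds R J.+1 isT).
  rewrite /zeta2 mulr_suml; apply: ler_sum => j _.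
  under eq_bigr do rewrite expR_powM.
  have x0 : 0 < j.+1%:R * t by rewrite mulr_gt0.
  set y := expR (- (j.+1%:R * t)).
  have y0 : 0 < y := expR_gt0 _.
  have y1 : y < 1 by rewrite /y expR_lt1 oppr_lt0.
  rewrite -mulr_suml sum_geom ?lt_eqF//.
  have /andP[_ h] := expRN_odds_bounds x0.
  rewrite (_ : _ / t = (j.+1%:R * t)^-1 / j.+1%:R); last first.
    by rewrite expr2 !invfM mulrAC.
  rewrite ler_wpM2r ?invr_ge0// (le_trans _ h)// -/y mulrAC ger_pMr ?divr_gt0//.
    by rewrite gerBl exprn_ge0 ?ltW.
  by rewrite subr_gt0.
apply/ler_addgt0Pr => e e0.
pose J := Num.truncn (N%:R / (1 - q) / e / t).
apply: le_trans (H J) _; rewrite lerD2l.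
have J0 : 0 < J.+1%:R * t by rewrite mulr_gt0.
apply: (@le_trans _ _ (N%:R * ((J.+1%:R * t)^-1 / (1 - q)))).
  rewrite ler_wpM2l// ler_wpM2r ?invr_ge0 ?(ltW q1')//.
  by rewrite /q -expRM_natl mulrN expRN_le.
rewrite (_ : _ * _ = N%:R / (1 - q) / (J.+1%:R * t)); last first.
  by rewrite mulrA mulrAC.
rewrite ler_pdivrMr// mulrCA -ler_pdivrMr ?mulr_gt0// invfM mulrA.
by rewrite ltW// truncnS_gt.
Qed.

(** The same exchange of sums: stopping at J costs 1 / (J t), and each j <= J costs at most 2, one
    from the lower bound 1 / x - 1 in [expRN_odds_bounds] and one from cutting the geometric sum at
    N. *)
Lemma sum_ln_ge t N J : 0 < t -> 1 <= t ^+ 2 * N%:R -> (0 < J)%N ->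
  pi ^+ 2 / 6 / t - (J%:R * t)^-1 - 2 * J%:R <=
  \sum_(d < N) - ln (1 - expR (- t) ^+ d.+1).
Proof.
move=> t0 tN J0; set q := expR (- t).
have N0 : 0 < N%:R :> R.
  by rewrite lt0r ler0n andbT; apply/eqP => N0; move: tN; rewrite N0 mulr0 ler10.
have q0 : 0 < q := expR_gt0 _.
have q1 : q < 1 by rewrite /q expR_lt1 oppr_lt0.
have qd d : 0 < q ^+ d.+1 < 1 by rewrite exprn_gt0//= exprn_ilt1 ?ltW.
apply: (@le_trans _ _ (\sum_(d < N) \sum_(j < J) (q ^+ d.+1) ^+ j.+1 / j.+1%:R)); last first.
  apply: ler_sum => d _.
  by have /(ln_series J)/andP[] := qd d.
rewrite exchange_big/=.
apply: (@le_trans _ _ (zeta2 R J / t - 2 * J%:R)).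
  rewrite lerD2r invfM -mulrBl ler_wpM2r ?invr_ge0 ?(ltW t0)//.
  by case/andP: (@zeta2_bounds R J J0).
have -> : 2 * J%:R = \sum_(j < J) 2 :> R by rewrite sumr_const card_ord mulr_natr.
rewrite /zeta2 mulr_suml -sumrB; apply: ler_sum => j _.
under eq_bigr do rewrite expR_powM.
have jt : t <= j.+1%:R * t by rewrite ler_peMl ?(ltW t0)// ler1n.
have x0 : 0 < j.+1%:R * t := lt_le_trans t0 jt.
set x := j.+1%:R * t in jt x0 *; set y := expR (- x).
have y0 : 0 < y := expR_gt0 _.
have y1 : y < 1 by rewrite /y expR_lt1 oppr_lt0.
have /andP[h1 h2] := expRN_odds_bounds x0; rewrite -/y in h1 h2.
rewrite -mulr_suml sum_geom ?lt_eqF// [y * _ / _]mulrAC.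
set g := y / (1 - y) in h1 h2 *.
have g0 : 0 <= g by rewrite divr_ge0// ?subr_ge0 ltW.
(* Two inverse bounds give 1 / (N x^2), at most 1 by the hypothesis on t^2 N. *)
have yN : y ^+ N * g <= 1.
  apply: (@le_trans _ _ ((N%:R * x)^-1 * x^-1)).
    apply: ler_pM => //; first by rewrite exprn_ge0 ?ltW.
    by rewrite /y -expRM_natl mulrN expRN_le ?mulr_gt0.
  rewrite -invfM invf_le1 ?mulr_gt0// (le_trans tN)// mulrC -mulrA -expr2.
  by rewrite ler_wpM2l ?(ltW N0)// lerXn2r ?nnegrE ?(ltW t0) ?(ltW x0).
apply: (@le_trans _ _ ((x^-1 - 2) / j.+1%:R)).
  rewrite mulrBl lerB// /x; last by rewrite ler_piMr// invf_le1 ?ltr0n// ler1n.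
  by rewrite le_eqVlt; apply/orP; left; apply/eqP; rewrite expr2 !invfM mulrAC.
by rewrite ler_wpM2r ?invr_ge0 ?ler0n//; lra.
Qed.

Lemma gf_parts q N : 0 <= q < 1 ->
  gf (parts N ++ parts N) q = expR (2 * \sum_(d < N) - ln (1 - q ^+ d.+1)).
Proof.
move=> /andP[q0 q1].
have -> : gf (parts N ++ parts N) q = gf (parts N) q ^+ 2 by rewrite gf_cat.
rewrite expRM_natl; congr (_ ^+ 2); rewrite -(sum_parts (fun d => - ln (1 - q ^+ d))).
rewrite expR_sum /gf big_seq [RHS]big_seq; apply: eq_bigr => d.
move=> /(allP (all_parts N)) d0.
by rewrite expRN lnK// posrE subr_gt0 exprn_ilt1// -lt0n.
Qed.

Lemma gf_parts_le t N : 0 < t ->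
  gf (parts N ++ parts N) (expR (- t)) <= expR (saddle ^+ 2 / t).
Proof.
move=> t0; rewrite gf_parts ?expR_ge0 ?expR_lt1 ?oppr_lt0// ler_expR saddle_sqr.
have := sum_ln_le N t0; set S := \sum_(d < N) _; set P := pi ^+ 2.
have -> : P / 3 / t = 2 * (P / 6 / t) by field; rewrite gt_eqF.
by lra.
Qed.

Lemma gf_parts_ge t N J : 0 < t -> 1 <= t ^+ 2 * N%:R -> (0 < J)%N ->
  expR (saddle ^+ 2 / t - 2 / (J%:R * t) - 4 * J%:R) <=
  gf (parts N ++ parts N) (expR (- t)).
Proof.
move=> t0 tN J0; rewrite gf_parts ?expR_ge0 ?expR_lt1 ?oppr_lt0// ler_expR saddle_sqr.
have := sum_ln_ge t0 tN J0; set S := \sum_(d < N) _; set P := pi ^+ 2.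
have -> : P / 3 / t = 2 * (P / 6 / t) by field; rewrite gt_eqF.
by lra.
Qed.
End GeneratingFunctionBounds.

(** * Lower bound for the number of pairs *)

Section LowerBound.
Variable R : realType.
Implicit Types (t w k : R) (n N J : nat).
Local Notation c := (saddle R).

Lemma saddle_bounds : 1 <= c <= 3.
Proof.
have c0 : 0 < c by rewrite /saddle divr_gt0 ?pi_gt0 ?sqrtr_gt0.
have := saddle_sqr R; have p2 := pi_ge2 R; have := pihalf_lt2 R => p4 cE.
have {}p4 : (pi : R) <= 4 by lra.
have h1 : 4 <= pi ^+ 2 :> R by rewrite expr2; nra.
have h2 : pi ^+ 2 <= 16 :> R by rewrite expr2; nra.
by apply/andP; split; rewrite leNgt; apply/negP => h; nra.
Qed.

Lemma saddle_gt0 : 0 < c.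
Proof. by case/andP: saddle_bounds => h _; lra. Qed.

(** Written so that both outer terms of [gf_split] leave a margin k^2 / 2: the first bound serves
    the tail above n, the third the range below n (1 - 5 k). *)
Lemma inv_bounds k : 0 < k <= 1 / 2 ->
  [/\ 1 - k + k ^+ 2 / 2 <= (1 + k)^-1, (1 + k)^-1 <= 1 &
      k - 9 / 2 * k ^+ 2 + (1 + 2 * k)^-1 <= (1 + k)^-1].
Proof.
move=> /andP[k0 k1]; have h1 : 0 < 1 + k by lra.
have h2 : 0 < 1 + 2 * k by lra.
split.
- by rewrite -[leRHS]mul1r ler_pdivlMr//; nra.
- by rewrite invf_le1//; lra.
rewrite -subr_ge0 (_ : _ - _ = k ^+ 2 * (3 / 2 + 23 / 2 * k + 9 * k ^+ 2) /
  ((1 + k) * (1 + 2 * k))); last by field; rewrite !gt_eqF.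
by rewrite divr_ge0 ?mulr_ge0 ?sqr_ge0 ?(ltW h1) ?(ltW h2)//; nra.
Qed.

(* Chernoff bounds on both sides: under the tilt t(1 + k) the mass sits below
   n, up to the two error terms. *)
Lemma gf_split t k n (m : R) : 0 < t -> 0 < k ->
  gf (parts n ++ parts n) (expR (- (t * (1 + k)))) <=
  expR (k * t * m) * expR (c ^+ 2 / (t * (1 + 2 * k))) +
  n.+1%:R * (p2 n)%:R * expR (- (t * (1 + k) * m)) +
  expR (- (k * t * n%:R)) * expR (c ^+ 2 / t).
Proof.
move=> t0 k0; set s := parts n ++ parts n.
have s0 : all (leq 1) s by rewrite all_cat !all_parts.
have t10 : 0 < t * (1 + k) by rewrite mulr_gt0//; lra.
have t20 : 0 < t * (1 + 2 * k) by rewrite mulr_gt0//; lra.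
have q01 (u : R) : 0 < u -> 0 <= expR (- u) < 1.
  by move=> u0; rewrite expR_ge0 expR_lt1 oppr_lt0.
have pow (u : R) j : expR (- u) ^+ j = expR (- (u * j%:R)).
  by rewrite -expRM_natr mulNr.
apply: gf_le => // [|X]; first exact: q01.
(* [A], [B] and [C] dominate the terms with j <= m, m < j <= n and j > n: the tilt is raised to t (1
   + 2 k), [p2] is bounded by its value at n, or the tilt is lowered to t. *)
pose A j : R := expR (k * t * m) * ((gcount s j)%:R * expR (- (t * (1 + 2 * k))) ^+ j).
pose B j : R := (j <= n)%:R * ((p2 n)%:R * expR (- (t * (1 + k) * m))).
pose C j : R := expR (- (k * t * n%:R)) * ((gcount s j)%:R * expR (- t) ^+ j).
apply: (@le_trans _ _ (\sum_(j < X) (A j + B j + C j))).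
  apply: ler_sum => j _.
  have A0 : 0 <= A j by rewrite !mulr_ge0 ?expR_ge0 ?exprn_ge0 ?expR_ge0.
  have B0 : 0 <= B j by rewrite !mulr_ge0 ?expR_ge0.
  have C0 : 0 <= C j by rewrite !mulr_ge0 ?expR_ge0 ?exprn_ge0 ?expR_ge0.
  have [jm|mj] := leP (j%:R : R) m.
    suff : (gcount s j)%:R * expR (- (t * (1 + k))) ^+ j <= A j by lra.
    rewrite /A !pow mulrCA ler_wpM2l// -expRD ler_expR.
    have : 0 <= k * t * (m - j%:R) by rewrite !mulr_ge0 ?subr_ge0 ?(ltW k0) ?(ltW t0).
    by lra.
  have [jn|nj] := leqP j n.
    suff : (gcount s j)%:R * expR (- (t * (1 + k))) ^+ j <= B j by lra.
    rewrite /B jn mul1r gcount_p2// pow ler_pM ?expR_ge0 ?ler_nat ?p2_le//.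
    rewrite ler_expR lerN2 ler_wpM2l ?(ltW t10)//; exact: ltW.
  suff : (gcount s j)%:R * expR (- (t * (1 + k))) ^+ j <= C j by lra.
  rewrite /C !pow mulrCA ler_wpM2l// -expRD ler_expR.
  have : 0 <= k * t * (j%:R - n%:R) 
    by rewrite !mulr_ge0 ?subr_ge0 ?ler_nat ?(ltW k0) ?(ltW t0) ?(ltnW nj).
  by lra.
rewrite !big_split/= -!mulr_sumr; apply: lerD; first apply: lerD.
- rewrite ler_wpM2l ?expR_ge0//.
  apply: le_trans (sum_gcount_le X (q01 _ t20) s0) _; exact: gf_parts_le.
- rewrite /B -mulr_suml -[leRHS]mulrA ler_wpM2r ?mulr_ge0 ?expR_ge0//.
  have -> : \sum_(j < X) (j <= n)%:R = (minn X n.+1)%:R :> R.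
    elim: X => [|X IH]; first by rewrite big_ord0 min0n.
    by rewrite big_ord_recr /= IH -natrD; congr (_%:R); case: leqP; lia.
  by rewrite ler_nat geq_minr.
- rewrite ler_wpM2l ?expR_ge0//.
  apply: le_trans (sum_gcount_le X (q01 _ t0) s0) _; exact: gf_parts_le.
Qed.

(** With w = n^(1/8), [gf_split] at the tilt t (1 + k) confines at least half of the mass to weights
    between n (1 - 5 k) and n, where [p2] is at most its value at n. The main exponent is 2 c sqrt
    n, and k sqrt n, of order w^3, sets the loss. *)
Lemma p2_ge n w : 20 <= w -> w ^+ 8 = n%:R ->
  expR (2 * c * w ^+ 4 - 200 * w ^+ 3) <= (p2 n)%:R.
Proof.
move=> w20 wn.
have w0 : 0 < w by lra.
have c0 := saddle_gt0; have /andP[c1 c3] := saddle_bounds.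
have w40 : 0 < w ^+ 4 by rewrite exprn_gt0.
(* The constant 6 makes T k^2 / 2 at least 18 w^2, above the 7 w^2 + 3 lost elsewhere. *)
pose t := c / w ^+ 4; pose k := 6 / w; pose T := c * w ^+ 4.
have t0 : 0 < t by rewrite divr_gt0.
have k0 : 0 < k by rewrite divr_gt0.
have k12 : k <= 1 / 2 by rewrite /k ler_pdivrMr//; lra.
have /inv_bounds[k1 k2 k3] : 0 < k <= 1 / 2 by rewrite k0.
set v := (1 + k)^-1 in k1 k2 k3; set v2 := (1 + 2 * k)^-1 in k3.
have tn : t * n%:R = T.
  by rewrite /t /T -wn; field; rewrite gt_eqF.
(* J of order w^2 balances the error terms 2 / (J t) and 4 J of [gf_parts_ge]. *)
pose J := (Num.truncn (w ^+ 2)).+1.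
have J1 : w ^+ 2 <= J%:R by rewrite ltW// truncnS_gt.
have J2 : J%:R <= w ^+ 2 + 1.
  by rewrite /J -natr1 lerD2r truncn_le// sqr_ge0.
have t10 : 0 < t * (1 + k) by rewrite mulr_gt0//; lra.
have w2 : 0 < w ^+ 2 by rewrite exprn_gt0.
have lo : expR (T * v - 7 * w ^+ 2) <= gf (parts n ++ parts n) (expR (- (t * (1 + k)))).
  have := @gf_parts_ge R (t * (1 + k)) n J t10 _ isT; set g := gf _ _.
  move=> h; apply: le_trans (h _); last first.
    have tt : t ^+ 2 * n%:R = c ^+ 2 by rewrite /t -wn; field; rewrite gt_eqF.
    rewrite exprMn mulrAC tt -[1]mul1r ler_pM//.
      by rewrite expr2; nra.
    by rewrite expr2; nra.
  rewrite ler_expR.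
  have -> : c ^+ 2 / (t * (1 + k)) = T * v.
    by rewrite /t /T /v; field; rewrite !gt_eqF//; lra.
  have : 2 / (J%:R * (t * (1 + k))) <= 2 * w ^+ 2.
    rewrite ler_pdivrMr; last by rewrite mulr_gt0 ?ltr0n.
    rewrite -[leLHS]mulr1 -mulrA ler_pM2l//.
    have tw : t * w ^+ 4 = c by rewrite /t divfK// gt_eqF.
    have : 1 <= w ^+ 2 * (w ^+ 2 * t).
      by rewrite mulrA -exprD mulrC tw.
    move=> h1; apply: le_trans h1 _; rewrite ler_wpM2l ?(ltW w2)//.
    apply: ler_pM => //; [exact: ltW|exact: ltW|].
    by rewrite -[leLHS]mulr1 ler_wpM2l ?(ltW t0)//; lra.
  have : 400 <= w ^+ 2 by rewrite expr2; nra.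
  by lra.
have Tk : 18 * w ^+ 2 <= T * (k ^+ 2 / 2).
  rewrite (_ : T * _ = c * (18 * w ^+ 2)); last by rewrite /T /k; field; rewrite gt_eqF.
  by rewrite ler_peMl// mulr_ge0// ltW.
have T0 : 0 < T by rewrite mulr_gt0.
have w400 : 400 <= w ^+ 2 by rewrite expr2; nra.
have E3 (a b : R) : b <= a - 3 -> expR b <= expR a / 4.
  move=> ab; apply: (@le_trans _ _ (expR (a - 3))); first by rewrite ler_expR.
  rewrite expRD ler_pM2l ?expR_gt0// expRN lef_pV2 ?posrE ?expR_gt0//.
  by have := expR_ge1Dx (3 : R); lra.
have := le_trans lo (gf_split n (n%:R * (1 - 5 * k)) t0 k0).
set a := T * v - 7 * w ^+ 2.
rewrite -!expRD => H.
have {}H : expR a <= expR a / 4 +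
    n.+1%:R * (p2 n)%:R * expR (- (t * (1 + k) * (n%:R * (1 - 5 * k)))) + expR a / 4.
  apply: le_trans H _; rewrite lerD ?lerD//; apply: E3.
    rewrite (_ : c ^+ 2 / _ = T * v2); last first.
      by rewrite /t /T /v2; field; rewrite !gt_eqF//; lra.
    rewrite (_ : k * t * _ = T * (k * (1 - 5 * k))); last by rewrite -tn; ring.
    have := ler_wpM2l (ltW T0) k3; rewrite /a; lra.
  rewrite (_ : c ^+ 2 / _ = T); last first.
    by rewrite /t /T; field; rewrite !gt_eqF//; lra.
  rewrite (_ : k * t * _ = T * k); last by rewrite -tn; ring.
  have := ler_wpM2l (ltW T0) k1; rewrite /a; lra.
set e := t * (1 + k) * _ in H.
have {}H : expR (a + e) <= 2 * n.+1%:R * (p2 n)%:R.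
  rewrite expRD -ler_pdivlMr ?expR_gt0// -expRN.
  rewrite -!mulrA [n.+1%:R * _]mulrA.
  by move: H; set z := _%:R * _ * _; lra.
have n2 : 2 * n.+1%:R <= expR (w ^+ 3).
  apply: le_trans (expR_ge1Dxn 2 (exprn_ge0 3 (ltW w0))).
  rewrite -[n.+1%:R]natr1 -wn -exprM (_ : (3 * 3)%N = (8.+1)%N)// [w ^+ 9]exprS.
  rewrite (_ : 3`!%:R = 6 :> R)//.
  have : 1 <= w ^+ 8 by rewrite exprn_ege1//; lra.
  set W := w ^+ 8 => W1.
  have : 20 * W <= w * W by rewrite ler_wpM2r//; lra.
  lra.
have pn0 : 0 < (p2 n)%:R :> R by rewrite ltr0n p2_gt0.
have {}H : expR (a + e - w ^+ 3) <= (p2 n)%:R.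
  rewrite expRD expRN ler_pdivrMr ?expR_gt0//.
  by apply: le_trans H _; rewrite mulrC ler_wpM2l// ltW.
apply: le_trans H; rewrite ler_expR.
have eE : e = T * ((1 + k) * (1 - 5 * k)) by rewrite /e -tn; ring.
have kw : T * k <= 18 * w ^+ 3.
  rewrite (_ : T * k = 6 * c * w ^+ 3); last by rewrite /T /k; field; rewrite gt_eqF.
  by rewrite ler_wpM2r ?exprn_ge0 ?(ltW w0)//; lra.
have ww : 7 * w ^+ 2 <= w ^+ 3 by rewrite exprS ler_wpM2r ?(ltW w2)//; lra.
have w30 : 0 < w ^+ 3 by rewrite exprn_gt0.
have := ler_wpM2l (ltW T0) k1.
have Tkk : T * k * k <= 9 * w ^+ 3 by nra.
rewrite eE /a (_ : 2 * c * w ^+ 4 = 2 * T); last by rewrite /T; ring.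
have : 0 <= T * (k ^+ 2 / 2) by lra.
rewrite (_ : T * ((1 + k) * (1 - 5 * k)) = T - 4 * (T * k) - 5 * (T * k * k)); last ring.
rewrite (_ : T * (1 - k + k ^+ 2 / 2) = T - T * k + T * (k ^+ 2 / 2)); last ring.
lra.
Qed.
End LowerBound.

(** * Local regularity of the number of pairs *)

Lemma all_iotaS m k : all (leq 1) (iota m.+1 k).
Proof. by apply/allP => d; rewrite mem_iota => /andP[md _]; apply: leq_trans md. Qed.

Section LocalRegularity.
Variable R : realType.
Local Notation c := (saddle R).

Definition root8 (x : R) : R := Num.sqrt (Num.sqrt (Num.sqrt x)).

Lemma root8K (x : R) : 0 <= x -> root8 x ^+ 8 = x.
Proof.
move=> x0; rewrite (_ : 8%N = (2 * 2 * 2)%N)// !exprM /root8.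
by rewrite !sqr_sqrtr ?sqrtr_ge0.
Qed.

Lemma root8_ge0 (x : R) : 0 <= root8 x.
Proof. exact: sqrtr_ge0. Qed.

(** For m >= 1, the probability that m occurs as a part of one chosen member of a uniform pair; 0
    for m > n through [rev_seq]. *)
Definition ratio (n m : nat) : R := (rev_seq p2 n m)%:R / (p2 n)%:R.

Lemma p2R_gt0 n : 0 < (p2 n)%:R :> R.
Proof. by rewrite ltr0n p2_gt0. Qed.

Lemma ratio_ge0 n m : 0 <= ratio n m.
Proof. by rewrite /ratio divr_ge0. Qed.

Lemma ratio_le n : {homo ratio n : m k / (m <= k)%N >-> k <= m}.
Proof.
move=> m k mk; rewrite /ratio ler_wpM2r ?invr_ge0// ler_nat /rev_seq.
case: (leqP k n) => // kn; rewrite (leq_trans mk kn) p2_le//; lia.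
Qed.

Lemma ratio0 n : ratio n 0 = 1.
Proof. by rewrite /ratio /rev_seq subn0 divff// gt_eqF ?p2R_gt0. Qed.

Lemma ratioD n m k : (m <= n)%N -> ratio n (m + k) = ratio n m * ratio (n - m) k.
Proof.
move=> mn; have -> : ratio n m = (p2 (n - m))%:R / (p2 n)%:R.
  by rewrite /ratio /rev_seq mn.
rewrite /ratio (_ : rev_seq p2 n (m + k) = rev_seq p2 (n - m) k).
  by field; rewrite !gt_eqF ?p2R_gt0.
rewrite /rev_seq subnDA.
by have -> : (m + k <= n)%N = (k <= n - m)%N by lia.
Qed.

(** z = n^(1/32) turns the scales into integer powers: sqrt n is z^16, the loss n^(3/8) is z^12,
    averages run over about z^15 indices, and base points range over z^29 below n. *)
Variables (n : nat) (z : R).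
Hypothesis z_ge : 201 * 128 <= z.
Hypothesis z32 : z ^+ 32 = n%:R.

Let z20 : 20 <= z. Proof. by have := z_ge; lra. Qed.
Let z0 : 0 < z. Proof. by have := z20; lra. Qed.
Let z1 : 1 <= z. Proof. by have := z20; lra. Qed.
Let zX k : 0 < z ^+ k. Proof. exact: exprn_gt0. Qed.

Definition tilt : R := c / z ^+ 16.
Local Notation t := tilt.
Local Notation q := (expR (- t)).

Let c0 : 0 < c := saddle_gt0 R.
Let c13 : 1 <= c <= 3 := saddle_bounds R.

Lemma tilt_gt0 : 0 < t.
Proof. by rewrite divr_gt0 ?zX. Qed.
Let t0 := tilt_gt0.

Lemma saddle_tilt : c ^+ 2 / t = t * n%:R.
Proof. by rewrite /tilt -z32; field; rewrite !gt_eqF ?zX. Qed.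

Let q_ge0 : 0 <= q. Proof. exact: expR_ge0. Qed.
Let q_lt1 : 0 <= q < 1. Proof. by rewrite q_ge0 expR_lt1 oppr_lt0. Qed.

Lemma qX m : q ^+ m = expR (- (t * m%:R)).
Proof. by rewrite -expRM_natr mulNr. Qed.

(** Base points k to which the single tilt t, adapted to n, still applies: chaining ratios moves the
    base point down from n by up to z^29. *)
Definition near_top (k : nat) := n%:R - z ^+ 29 <= k%:R /\ (k <= n)%N.

Lemma near_top_n : near_top n.
Proof. by split=> //; rewrite lerBlDr lerDl ltW ?zX. Qed.

(** The saddle point exponent c^2 / t + t k exceeds 2 c sqrt k by t (sqrt n - sqrt k)^2. Near the
    top sqrt n - sqrt k <= z^13, so the excess is at most c z^10 <= z^12; the other 200 z^12 are the
    loss in [p2_ge]. *)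
Lemma p2_near_top k : near_top k ->
  expR (c ^+ 2 / t + t * k%:R) <= expR (201 * z ^+ 12) * (p2 k)%:R.
Proof.
move=> [nk kn]; pose w := root8 k%:R.
have w0 : 0 <= w := root8_ge0 _.
have w8 : w ^+ 8 = k%:R by rewrite root8K.
have wz : w <= z ^+ 4.
  rewrite -(@ler_pXn2r _ 8)// ?nnegrE ?(ltW (zX _))//.
  by rewrite w8 -exprM z32 ler_nat.
have z3 : 20 <= z ^+ 3.
  by apply: (le_trans z20); rewrite -{1}[z]expr1 ler_weXn2l.
have w20 : 20 <= w.
  rewrite leNgt; apply/negP => w20.
  have : w ^+ 8 <= z ^+ 8.
    by rewrite lerXn2r ?nnegrE ?(ltW z0)// (le_trans (ltW w20))// (le_trans _ z20).
  rewrite w8 => k8; have {}k8 := le_trans nk k8; move: k8.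
  rewrite -z32 (_ : 32%N = (3 + 29)%N)// exprD.
  have : z ^+ 8 <= z ^+ 29 by rewrite ler_weXn2l.
  have := zX 29; set Z := z ^+ 29 => Z0 Z8.
  have : 20 * Z <= z ^+ 3 * Z by rewrite ler_wpM2r// ltW.
  lra.
have lo := p2_ge w20 w8.
apply: le_trans (ler_wpM2l (expR_ge0 _) lo); rewrite -expRD ler_expR.
have w12 : w ^+ 3 <= z ^+ 12.
  by rewrite (_ : 12%N = (4 * 3)%N)// exprM lerXn2r ?nnegrE// ltW.
suff : c ^+ 2 / t + t * k%:R - 2 * c * w ^+ 4 <= z ^+ 12 by lra.
have wz4 : w ^+ 4 <= z ^+ 16.
  by rewrite (_ : 16%N = (4 * 4)%N)// exprM lerXn2r ?nnegrE// ltW.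
have -> : c ^+ 2 / t + t * k%:R - 2 * c * w ^+ 4 = t * (z ^+ 16 - w ^+ 4) ^+ 2.
  rewrite saddle_tilt -z32 -w8 /tilt.
  rewrite (_ : 32%N = (16 * 2)%N)// (_ : 8%N = (4 * 2)%N)// [z ^+ (16 * 2)]exprM [w ^+ (4 * 2)]exprM.
  by field; rewrite gt_eqF ?zX.
have d13 : z ^+ 16 - w ^+ 4 <= z ^+ 13.
  rewrite -(ler_pM2r (zX 16)) -exprD.
  have : (z ^+ 16 - w ^+ 4) * (z ^+ 16 + w ^+ 4) <= z ^+ 29.
    rewrite -subr_sqr -!exprM w8 z32; lra.
  apply: le_trans; rewrite ler_wpM2l ?subr_ge0//.
  by rewrite lerDl exprn_ge0.
apply: (@le_trans _ _ (t * (z ^+ 13) ^+ 2)).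
  by rewrite ler_wpM2l ?(ltW t0)// lerXn2r ?nnegrE ?subr_ge0 ?(ltW (zX _)).
rewrite /tilt -mulrA [_^-1 * _]mulrC -exprM (_ : (13 * 2)%N = (10 + 16)%N)// exprD mulfK ?gt_eqF//.
rewrite (_ : 12%N = (2 + 10)%N)// [z ^+ (2 + 10)]exprD ler_wpM2r ?(ltW (zX _))//.
case/andP: c13 => _ c3; apply: (le_trans c3).
by rewrite expr2; have := z20; nra.
Qed.

(** [gcount_tilt] in logarithmic form, where the conditioning costs 201 z^12 by [p2_near_top]. The
    sum of the [ratio k d] is the conditional mean number of d in the interval that occur. Both
    signs of [th] will be used. *)
Lemma tilt_interval k s L (th : R) : near_top k -> (s + L <= n)%N ->
  th * \sum_(d <- iota s.+1 L) ratio k d <=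
  (expR th - 1) * \sum_(d <- iota s.+1 L) q ^+ d + 201 * z ^+ 12.
Proof.
move=> kt sL; set I := iota s.+1 L.
have [nk kn] := kt.
(* All other part sizes up to n: the rest of the first copy and the whole second copy. *)
pose s' := iota 1 s ++ iota (s + L).+1 (n - (s + L)) ++ parts n.
have I0 : all (leq 1) I := all_iotaS _ _.
have s'0 : all (leq 1) s'.
  by rewrite !all_cat all_parts andbT !all_iotaS.
have pE : perm_eq (I ++ s') (parts n ++ parts n).
  rewrite /s' [iota 1 s ++ _]catA catA perm_cat2r /parts perm_sym perm_rev.
  rewrite -{1}(subnKC sL) !iotaD -catA perm_catCA add1n.
  by rewrite (_ : (1 + (s + L) = (s + L).+1)%N).
have gE : gcount (I ++ s') =1 gcount (parts n ++ parts n).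
  by apply: gcount_perm pE; rewrite all_cat I0.
set m := \sum_(d <- I) ratio k d.
have mE : \sum_(d <- I) (rev_seq (gcount (I ++ s')) k d)%:R =
    m * (gcount (I ++ s') k)%:R :> R.
  rewrite /m mulr_suml gE gcount_p2//; apply: eq_bigr => d _.
  rewrite /ratio divfK ?gt_eqF ?p2R_gt0// (eq_rev_seq _ _ gE) /rev_seq.
  by case: ifP => // _; rewrite gcount_p2// (leq_trans (leq_subr _ _) kn).
have := gcount_tilt th q_lt1 I0 s'0 mE.
rewrite gE gcount_p2// (_ : gf (I ++ s') q = gf (parts n ++ parts n) q); last first.
  exact: perm_big.
set S := \sum_(d <- I) q ^+ d => H.
have {}H : (p2 k)%:R * expR (th * m) <= expR ((expR th - 1) * S) * (expR (201 * z ^+ 12) * (p2 k)%:R).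
  apply: le_trans (ler_wpM2l (expR_ge0 _) (p2_near_top kt)).
  rewrite expRD mulrA -ler_pdivrMr ?expR_gt0// -expRN -qX.
  by apply: le_trans H _; rewrite ler_wpM2l ?expR_ge0// gf_parts_le.
move: H; rewrite mulrC mulrA ler_pM2r ?p2R_gt0// -expRD ler_expR.
by [].
Qed.

(** Long enough to make the averaged cost z^12 z / z^15 small, for th of size 1 / z, and short
    enough for q^d to vary over it only by a factor exp (O(1 / z)). *)
Definition width : nat := Num.truncn (z ^+ 15).
(** About sqrt n, a range on which q^m stays bounded below. *)
Definition step : nat := Num.truncn (z ^+ 16).

Lemma width_bounds : z ^+ 15 / 2 <= width%:R <= z ^+ 15.
Proof.
have := truncn_le (z ^+ 15); have := truncnS_gt (z ^+ 15).
have : 1 <= z ^+ 14 by rewrite exprn_ege1.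
rewrite -/width -[width.+1%:R]natr1 (ltW (zX 15)) => h h1 h2; rewrite h2 andbT.
have : 20 * 1 <= z * z ^+ 14 by rewrite ler_pM.
rewrite -exprS; lra.
Qed.

Lemma step_bounds : z ^+ 16 / 2 <= step%:R <= z ^+ 16.
Proof.
have := truncn_le (z ^+ 16); have := truncnS_gt (z ^+ 16).
have : 1 <= z ^+ 15 by rewrite exprn_ege1.
rewrite -/step -[step.+1%:R]natr1 (ltW (zX 16)) => h h1 h2; rewrite h2 andbT.
have : 20 * 1 <= z * z ^+ 15 by rewrite ler_pM.
rewrite -exprS; lra.
Qed.

Lemma expR_le_inv (x : R) : 0 <= x < 1 -> expR x <= (1 - x)^-1.
Proof.
move=> /andP[x0 x1]; rewrite -[x in expR x]opprK expRN lef_pV2 ?posrE ?expR_gt0//.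
  by have := expR_ge1Dx (- x); lra.
by lra.
Qed.

Lemma expRN_le_inv (x : R) : 0 <= x -> expR (- x) <= (1 + x)^-1.
Proof.
move=> x0; rewrite expRN lef_pV2 ?posrE ?expR_gt0 ?expR_ge1Dx//; lra.
Qed.

Lemma expR3_le : expR (3 : R) <= 64.
Proof.
rewrite (_ : 3 = 6%:R * 2^-1 :> R); last by field.
rewrite expRM_natl (_ : 64 = 2 ^+ 6 :> R); last by rewrite -natrX.
rewrite lerXn2r ?nnegrE ?expR_ge0//.
apply: le_trans (expR_le_inv _) _; first by lra.
by rewrite -[leRHS]invrK lef_pV2 ?posrE; lra.
Qed.

(** q^m >= e^(-3) >= 1 / 64 for m <= [step], and [width] >= z^15 / 2, so that 201 * 128 <= z
    suffices; this fixes the assumption on z. *)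
Lemma ratio_small_error m : (m <= step)%N ->
  201 * z ^+ 12 * z / width%:R <= z^-1 * q ^+ m.
Proof.
move=> mh; have /andP[w1 w2] := width_bounds; have /andP[_ h2] := step_bounds.
have w0 : 0 < width%:R :> R by apply: lt_le_trans w1; rewrite divr_gt0 ?zX.
have q64 : 64^-1 <= q ^+ m.
  rewrite qX expRN lef_pV2 ?posrE ?expR_gt0//; apply: le_trans expR3_le.
  rewrite ler_expR /tilt mulrAC ler_pdivrMr ?zX//.
  case/andP: c13 => c1 c3; apply: ler_pM => //.
    exact: ltW.
  by apply: le_trans h2; rewrite ler_nat.
apply: le_trans (ler_wpM2l _ q64); last by rewrite invr_ge0 ltW.
rewrite ler_pdivrMr//.
apply: (@le_trans _ _ (z^-1 / 64 * (z ^+ 15 / 2))); last first.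
  by rewrite ler_wpM2l// divr_ge0// invr_ge0 ltW.
rewrite (_ : z ^+ 15 = z * z * z ^+ 13); last by rewrite -expr2 -exprD.
rewrite (_ : _ / 64 * _ = z / 128 * z ^+ 13); last by field; rewrite gt_eqF.
rewrite -mulrA -exprSr ler_wpM2r ?(ltW (zX _))//.
by have := z_ge; lra.
Qed.

Lemma tilt_width : t * width%:R <= 3 / z.
Proof.
have /andP[_ w2] := width_bounds; case/andP: c13 => _ c3.
apply: (@le_trans _ _ (t * z ^+ 15)); first by rewrite ler_wpM2l// ltW.
rewrite /tilt [z ^+ 16]exprS.
rewrite (_ : c / _ * _ = c / z); last by field; rewrite !gt_eqF ?zX.
by rewrite ler_wpM2r ?invr_ge0 ?(ltW z0).
Qed.

Let zV : 0 < z^-1 <= 1 / 20.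
Proof. by rewrite invr_gt0 z0/= div1r lef_pV2 ?posrE. Qed.

(** As [ratio] is nonincreasing in m, its value at m is at most its average over the [width] indices
    up to m, which [tilt_interval] with th = 1 / z compares with q^(m - width). *)
Lemma ratio_le_tilt k m : near_top k -> (m <= step)%N ->
  ratio k m <= expR (10 / z) * q ^+ m.
Proof.
move=> kt mh; have /andP[v0 v1] := zV.
have err := ratio_small_error mh; have tw := tilt_width.
have /andP[w1 w2] := width_bounds; have /andP[_ h2] := step_bounds.
have w0 : 0 < width%:R :> R by apply: lt_le_trans w1; rewrite divr_gt0 ?zX.
have q0 : 0 < q ^+ m by rewrite exprn_gt0 ?expR_gt0.
(* Below [width] the interval does not fit, but there q^m is within a factor exp (3 / z) of 1. *)
case: (leqP width m) => wm; last first.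
  apply: (@le_trans _ _ 1); first by rewrite -(ratio0 k) ratio_le.
  rewrite qX -expRD -[leLHS]expR0 ler_expR.
  have : t * m%:R <= t * width%:R by rewrite ler_wpM2l ?(ltW t0)// ler_nat ltnW.
  by lra.
have mn : (m - width + width <= n)%N.
  rewrite subnK// -(ler_nat R) -z32; apply: (@le_trans _ _ step%:R); first by rewrite ler_nat.
  by apply: (le_trans h2); rewrite ler_weXn2l.
have := tilt_interval z^-1 kt mn.
set I := iota _ _.
have rI : width%:R * ratio k m <= \sum_(d <- I) ratio k d.
  rewrite -(size_iota (m - width).+1 width) -/I -sum1_size natr_sum mulr_suml.
  rewrite big_seq [leRHS]big_seq; apply: ler_sum => d.
  rewrite mem_iota mul1r addSn ltnS subnK// => /andP[_ dm].
  exact: ratio_le.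
have qI : \sum_(d <- I) q ^+ d <= width%:R * q ^+ (m - width).
  rewrite -[X in X%:R * _](size_iota (m - width).+1 width) -/I -sum1_size natr_sum mulr_suml.
  rewrite big_seq [leRHS]big_seq; apply: ler_sum => d.
  rewrite mem_iota mul1r => /andP[dm _].
  by rewrite !qX ler_expR lerN2 ler_wpM2l ?(ltW t0)// ler_nat ltnW.
have ez : expR z^-1 - 1 <= z^-1 * (1 + 2 * z^-1).
  have : expR z^-1 <= (1 - z^-1)^-1 by apply: expR_le_inv; lra.
  suff : (1 - z^-1)^-1 <= 1 + z^-1 * (1 + 2 * z^-1) by lra.
  by rewrite -[leLHS]mul1r ler_pdivrMr; [nra|lra].
have e0 : 0 <= expR z^-1 - 1 by have := expR_ge1Dx z^-1; lra.
move=> H.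
have {}H : z^-1 * (width%:R * ratio k m) <=
    z^-1 * (1 + 2 * z^-1) * (width%:R * q ^+ (m - width)) + 201 * z ^+ 12.
  apply: le_trans (ler_wpM2l (ltW v0) rI) _; apply: le_trans H _; rewrite lerD2r.
  apply: le_trans (ler_wpM2l e0 qI) _.
  by rewrite ler_wpM2r ?ez ?mulr_ge0 ?exprn_ge0.
have {}H : ratio k m <= (1 + 2 * z^-1) * q ^+ (m - width) + 201 * z ^+ 12 * z / width%:R.
  have zw : 0 < z^-1 * width%:R by rewrite mulr_gt0.
  rewrite -(ler_pM2l zw) mulrDr (_ : _ * (_ / width%:R) = 201 * z ^+ 12); last first.
    by field; rewrite !gt_eqF.
  by move: H; rewrite !mulrA [_ * width%:R * (1 + _)]mulrAC.
apply: (le_trans H).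
have qw : q ^+ (m - width) <= expR (3 * z^-1) * q ^+ m.
  rewrite !qX -expRD ler_expR natrB//; lra.
have e2 : 1 + 2 * z^-1 <= expR (2 * z^-1) by exact: expR_ge1Dx.
(* Of the 10 / z, 2 / z comes from e^(1 / z) - 1 and 3 / z from the spread of q^d over the interval;
   the rest covers the additive error. *)
apply: (@le_trans _ _ ((expR (5 * z^-1) + z^-1) * q ^+ m)).
  rewrite [leRHS]mulrDl lerD//.
  rewrite (_ : 5 * z^-1 = 2 * z^-1 + 3 * z^-1); last ring.
  rewrite expRD -mulrA; apply: ler_pM => //; lra.
rewrite ler_wpM2r ?(ltW q0)// (_ : 10 / z = 5 * z^-1 + 5 * z^-1); last by ring.
rewrite [leRHS]expRD.
have := expR_ge1Dx (5 * z^-1); set e := expR _ => e1.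
by nra.
Qed.

(** The mirror image: the average over the [width] indices after m, with th = - 1 / z. *)
Lemma ratio_ge_tilt k m : near_top k -> (m <= step)%N ->
  expR (- (10 / z)) * q ^+ m <= ratio k m.
Proof.
move=> kt mh; have /andP[v0 v1] := zV.
have err := ratio_small_error mh; have tw := tilt_width.
have /andP[w1 w2] := width_bounds; have /andP[_ h2] := step_bounds.
have w0 : 0 < width%:R :> R by apply: lt_le_trans w1; rewrite divr_gt0 ?zX.
have q0 : 0 < q ^+ m by rewrite exprn_gt0 ?expR_gt0.
have mn : (m + width <= n)%N.
  rewrite -(ler_nat R) -z32 natrD.
  have mz : m%:R <= z ^+ 16 by apply: le_trans h2; rewrite ler_nat.
  have : z ^+ 15 <= z ^+ 31 by rewrite ler_weXn2l.
  have : z ^+ 16 <= z ^+ 31 by rewrite ler_weXn2l.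
  have : 20 * z ^+ 31 <= z ^+ 32 by rewrite [z ^+ 32]exprS ler_wpM2r ?(ltW (zX _)).
  by have := zX 31; lra.
have := tilt_interval (- z^-1) kt mn.
set I := iota _ _.
have rI : \sum_(d <- I) ratio k d <= width%:R * ratio k m.
  rewrite -(size_iota m.+1 width) -/I -sum1_size natr_sum mulr_suml.
  rewrite big_seq [leRHS]big_seq; apply: ler_sum => d.
  by rewrite mem_iota mul1r => /andP[dm _]; apply: ratio_le; apply: ltnW.
have qI : width%:R * q ^+ (m + width) <= \sum_(d <- I) q ^+ d.
  rewrite -[X in X%:R * _](size_iota m.+1 width) -/I -sum1_size natr_sum mulr_suml.
  rewrite big_seq [leRHS]big_seq; apply: ler_sum => d.
  rewrite mem_iota mul1r addSn ltnS => /andP[_ dm].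
  by rewrite !qX ler_expR lerN2 ler_wpM2l ?(ltW t0)// ler_nat.
have ez : z^-1 * (1 - z^-1) <= 1 - expR (- z^-1).
  have : expR (- z^-1) <= (1 + z^-1)^-1 by apply: expRN_le_inv; lra.
  suff : (1 + z^-1)^-1 <= 1 - z^-1 * (1 - z^-1) by lra.
  by rewrite -[leLHS]mul1r ler_pdivrMr; [nra|lra].
move=> H.
have {}H : z^-1 * (1 - z^-1) * (width%:R * q ^+ (m + width)) - 201 * z ^+ 12 <=
    z^-1 * (width%:R * ratio k m).
  have h1 := ler_wpM2l (ltW v0) rI.
  have h3 : z^-1 * (1 - z^-1) * (width%:R * q ^+ (m + width)) <=
      (1 - expR (- z^-1)) * \sum_(d <- I) q ^+ d.
    by apply: ler_pM => //; rewrite mulr_ge0; lra.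
  lra.
have {}H : (1 - z^-1) * q ^+ (m + width) - 201 * z ^+ 12 * z / width%:R <= ratio k m.
  have zw : 0 < z^-1 * width%:R by rewrite mulr_gt0.
  rewrite -(ler_pM2l zw) mulrBr (_ : _ * (_ / width%:R) = 201 * z ^+ 12); last first.
    by field; rewrite !gt_eqF.
  by move: H; rewrite !mulrA [_ * width%:R * (1 - _)]mulrAC.
apply: le_trans H.
have qw : (1 - 3 * z^-1) * q ^+ m <= q ^+ (m + width).
  rewrite exprD mulrC ler_wpM2l ?(ltW q0)// qX.
  by have := expR_ge1Dx (- (t * width%:R)); lra.
have h1 : (1 - z^-1) * ((1 - 3 * z^-1) * q ^+ m) <= (1 - z^-1) * q ^+ (m + width).
  by rewrite ler_wpM2l//; lra.
suff h3 : expR (- (10 / z)) * q ^+ m <= (1 - 5 * z^-1) * q ^+ m.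
  have : 0 <= 3 * z^-1 * z^-1 * q ^+ m by rewrite !mulr_ge0// ltW.
  by nra.
rewrite ler_wpM2r ?(ltW q0)//.
apply: (le_trans (expRN_le_inv _)); first by rewrite divr_ge0// ltW.
by rewrite -[leLHS]mul1r ler_pdivrMr; [nra|lra].
Qed.

Let z29n : z ^+ 29 <= n%:R.
Proof. by rewrite -z32 ler_weXn2l. Qed.

Lemma step_gt0 : 0 < step%:R :> R.
Proof.
by case/andP: step_bounds => h _; apply: lt_le_trans h; rewrite divr_gt0 ?zX.
Qed.

Lemma near_top_sub m : m%:R <= z ^+ 29 -> near_top (n - m).
Proof.
move=> mz; split; last exact: leq_subr.
rewrite natrB ?lerD2l ?lerN2//.
by rewrite -(ler_nat R); apply: le_trans z29n.
Qed.

(** Induction in blocks of length [step]: each block costs a factor exp (10 / z) either way, at a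
    base point that is still near the top, and there are at most 1 + m / step blocks. *)
Lemma ratio_chain m : m%:R <= z ^+ 29 ->
  expR (- (10 / z * (1 + m%:R / step%:R))) * q ^+ m <= ratio n m <=
  expR (10 / z * (1 + m%:R / step%:R)) * q ^+ m.
Proof.
have s0 := step_gt0; have d0 : 0 <= 10 / z by rewrite divr_ge0 ?(ltW z0).
have q0 k : 0 < q ^+ k by rewrite exprn_gt0 ?expR_gt0.
elim/ltn_ind: m => m IH mz.
case: (leqP m step) => ms.
  have h : 10 / z <= 10 / z * (1 + m%:R / step%:R).
    by rewrite ler_peMr// lerDl divr_ge0.
  apply/andP; split.
    apply: le_trans (ratio_ge_tilt near_top_n ms).
    by rewrite ler_wpM2r ?(ltW (q0 _))// ler_expR lerN2.
  apply: le_trans (ratio_le_tilt near_top_n ms) _.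
  by rewrite ler_wpM2r ?(ltW (q0 _))// ler_expR.
have sm := ltnW ms.
have s_gt0 : (0 < step)%N by rewrite -(ltr_nat R).
have mz' : (m - step)%:R <= z ^+ 29.
  by apply: le_trans mz; rewrite ler_nat leq_subr.
have ms_lt : (m - step < m)%N by rewrite ltn_subrL s_gt0 (leq_trans s_gt0).
have /andP[lo up] := IH _ ms_lt mz'.
have nt := near_top_sub mz'.
have msn : (m - step <= n)%N by rewrite -(ler_nat R); apply: le_trans z29n.
have lo' := ratio_ge_tilt nt (leqnn step).
have up' := ratio_le_tilt nt (leqnn step).
rewrite -(subnK sm) (ratioD _ msn) subnK//.
have e : (m - step)%:R / step%:R = m%:R / step%:R - 1 :> R.
  by rewrite natrB// mulrBl divff// gt_eqF.
have qm : q ^+ m = q ^+ (m - step) * q ^+ step by rewrite -exprD subnK.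
rewrite e in lo up.
apply/andP; split.
  rewrite (_ : - _ = - (10 / z * (1 + (m%:R / step%:R - 1))) - 10 / z); last by ring.
  rewrite expRD qm [leLHS]mulrACA; apply: ler_pM => //; by rewrite mulr_ge0 ?expR_ge0 ?(ltW (q0 _)).
rewrite (_ : 10 / z * (1 + _) = 10 / z * (1 + (m%:R / step%:R - 1)) + 10 / z); last by ring.
rewrite expRD qm [leRHS]mulrACA; apply: ler_pM => //; exact: ratio_ge0.
Qed.

Hypothesis lnz_ge1 : 1 <= ln z.
Hypothesis lnz_le : 1000 * ln z <= z.

(** A single estimate for all m, in the form that [prod_diff_le] takes. The slightly slower rate
    yields a slack exp (2 m / (step ln z)), which absorbs the errors accumulated over the blocks,
    while the prefactor still tends to 0. *)
Lemma ratio_approx m :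
  `|ratio n m - q ^+ m| <=
  160 * ln z / z * expR (- t + 2 / (step%:R * ln z)) ^+ m.
Proof.
have l_ge := lnz_ge1; have l_le := lnz_le; set l := ln z in l_ge l_le *.
have l0 : 0 < l by apply: lt_le_trans l_ge.
have s0 := step_gt0; have /andP[_ h2] := step_bounds.
have q0 : 0 < q ^+ m by rewrite exprn_gt0 ?expR_gt0.
set u := 2 / (step%:R * l).
have u0 : 0 < u by rewrite divr_gt0 ?mulr_gt0.
have -> : expR (- t + u) ^+ m = q ^+ m * expR (u * m%:R).
  by rewrite expRD exprMn -[expR u ^+ m]expRM_natr.
have lz0 : 0 <= l / z by rewrite divr_ge0 ?(ltW l0) ?(ltW z0).
(* For m > z^29 the cruder bound p(n - m) <= G q^(m - n) is enough: the slack exceeds exp (201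
   z^12). *)
have [mz|zm] := leP (m%:R : R) (z ^+ 29); last first.
  have up : ratio n m <= expR (201 * z ^+ 12) * q ^+ m.
    rewrite /ratio ler_pdivrMr ?p2R_gt0// /rev_seq; case: leqP => mn; last first.
      by rewrite !mulr_ge0 ?expR_ge0 ?(ltW q0).
    rewrite mulrAC; apply: le_trans (ler_wpM2r (ltW q0) (p2_near_top near_top_n)).
    rewrite qX -expRD.
    have := @gcount_le_gf R (parts n ++ parts n) q (n - m) q_lt1.
    rewrite all_cat all_parts gcount_p2 ?leq_subr// => /(_ isT).
    rewrite qX expRN ler_pdivrMr ?expR_gt0// => h; apply: (le_trans h).
    apply: (@le_trans _ _ (expR (c ^+ 2 / t) * expR (t * (n - m)%:R))).
      by rewrite ler_wpM2r ?expR_ge0// gf_parts_le.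
    by rewrite -expRD ler_expR natrB//; lra.
  have E1 : 1 <= expR (201 * z ^+ 12) by rewrite -[leLHS]expR0 ler_expR mulr_ge0 ?(ltW (zX _)).
  have h : `|ratio n m - q ^+ m| <= expR (201 * z ^+ 12) * q ^+ m.
    have := ratio_ge0 n m; rewrite ler_norml => r0; apply/andP; split; last by lra.
    have : 1 * q ^+ m <= expR (201 * z ^+ 12) * q ^+ m by rewrite ler_wpM2r ?(ltW q0).
    by lra.
  apply: (le_trans h); rewrite [leLHS]mulrC [leRHS]mulrCA ler_wpM2l ?(ltW q0)//.
  apply: (@le_trans _ _ (expR (- l) * expR (u * m%:R))); last first.
    rewrite ler_wpM2r ?expR_ge0// expRN /l lnK ?posrE// -/l.
    by rewrite -[leLHS]mul1r ler_wpM2r ?invr_ge0 ?(ltW z0)//; lra.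
  rewrite -expRD ler_expR.
  have um : 2 * z ^+ 13 <= u * m%:R * l.
    rewrite (_ : u * m%:R * l = 2 * (m%:R / step%:R)); last first.
      by rewrite /u; field; rewrite !gt_eqF.
    rewrite ler_pM2l// ler_pdivlMr//; apply: (@le_trans _ _ (z ^+ 29)); last exact: ltW.
    by rewrite (_ : 29%N = (13 + 16)%N)// exprD ler_wpM2l ?(ltW (zX _)).
  have lz : l * (201 * z ^+ 12 + l) <= 2 * z ^+ 13.
    have l12 : l <= z ^+ 12.
      apply: (@le_trans _ _ z); first by lra.
      by rewrite -[leLHS]expr1 ler_weXn2l.
    apply: (@le_trans _ _ (l * (202 * z ^+ 12))); first by rewrite ler_wpM2l ?(ltW l0)//; lra.
    rewrite [z ^+ 13]exprS mulrA mulrA ler_wpM2r ?(ltW (zX _))//; lra.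
  have := le_trans lz um; rewrite [u * _ * l]mulrC ler_pM2l//; lra.
have /andP[lo up] := ratio_chain mz.
set y := 10 / z * _ in lo up.
(* As y = 10 (l / z) Y <= Y, one has y e^y <= 10 (l / z) e^(2 Y), and e^(2 Y) is the slack times
   e^(2 / l) <= 16; hence the 160. *)
pose Y := (1 + m%:R / step%:R) / l.
have yE : y = 10 * (l / z) * Y by rewrite /y /Y; field; rewrite !gt_eqF.
have Y0 : 0 <= Y by rewrite divr_ge0 ?addr_ge0 ?divr_ge0 ?(ltW l0).
have lz1 : 10 * (l / z) <= 1.
  by rewrite mulrA ler_pdivrMr//; lra.
have lz10 : 0 <= 10 * (l / z) by exact: mulr_ge0.
have y0 : 0 <= y by rewrite yE mulr_ge0.
have yY : y <= Y by rewrite yE ler_piMl.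
have key : `|ratio n m - q ^+ m| <= y * expR y * q ^+ m.
  have e1 := expR_ge1Dx (- y); have e2 := expR_ge1Dx y.
  have ee : expR y * expR (- y) = 1 by rewrite expRxMexpNx_1.
  have e0 := expR_gt0 y.
  have h1 : expR y - 1 <= y * expR y by nra.
  have h3 : 1 - expR (- y) <= y * expR y by nra.
  have h1' := ler_wpM2r (ltW q0) h1; have h3' := ler_wpM2r (ltW q0) h3.
  by rewrite ler_norml; apply/andP; split; lra.
apply: (le_trans key); rewrite [_ * (q ^+ m * _)]mulrCA [leLHS]mulrC ler_wpM2l ?(ltW q0)//.
rewrite {1}yE (_ : 160 * l / z = 10 * (l / z) * 16); last by ring.
rewrite -[leRHS]mulrA -[leLHS]mulrA ler_wpM2l//.
apply: (@le_trans _ _ (expR Y * expR Y)).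
  apply: ler_pM; rewrite ?expR_ge0// ?ler_expR//.
  by apply: le_trans (expR_ge1Dx Y); rewrite lerDr.
have -> : expR Y * expR Y = expR (2 / l) * expR (u * m%:R).
  by rewrite -!expRD; congr expR; rewrite /Y /u; field; rewrite !gt_eqF.
rewrite ler_wpM2r ?expR_ge0//.
apply: (@le_trans _ _ (expR (4%:R * (1 / 2)))).
  by rewrite ler_expR ler_pdivrMr//; lra.
rewrite expRM_natl (_ : 16 = 2 ^+ 4 :> R); last by rewrite -natrX.
rewrite lerXn2r ?nnegrE ?expR_ge0//.
apply: le_trans (expR_le_inv _) _; first by lra.
by rewrite -[leRHS]invrK lef_pV2 ?posrE; lra.
Qed.
End LocalRegularity.

(** * From counts to probabilities *)

Section Limit.
Variable R : realType.
Implicit Types (x t r : R) (a b n : nat).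
Local Notation c := (saddle R).

Lemma sum_iota (F : nat -> R) m L : \sum_(k <- iota m L) F k = \sum_(d < L) F (m + d)%N.
Proof.
rewrite -[m]addn0 iotaDl big_map -[X in iota 0 X]subn0 -/(index_iota 0 L) big_mkord.
by apply: eq_bigr => d _; rewrite addn0.
Qed.

Lemma sum_iota_exp t a L : 0 < t ->
  \sum_(k <- iota a.+1 L) expR (- t) ^+ k =
  expR (- t) ^+ a * (expR (- t) / (1 - expR (- t))) * (1 - expR (- t) ^+ L).
Proof.
move=> t0; rewrite sum_iota; under eq_bigr do rewrite addSn -addnS exprD.
rewrite -mulr_sumr sum_geom ?lt_eqF ?expR_lt1 ?oppr_lt0//.
by rewrite -!mulrA; congr (_ * (_ * _)); rewrite mulrC.
Qed.

(** The condition on a says that q^a is t e^(-x) up to a factor e^t, so the sum S of the q^k for k >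
    a, about q^a / t, is close to e^(-x). The bounds 1 - u <= e^(-u) and 1 - u >= e^(- u / (1 - u))
    pass from S to the product, and q^n <= 2 t^2 controls the cut at n. *)
Lemma prod_iota_bounds x t a n : 0 < t -> t <= 1 -> (a <= n)%N ->
  t * a%:R <= x - ln t < t * a.+1%:R -> expR (- t) ^+ n <= 2 * t ^+ 2 ->
  t * expR (t - x) < 1 ->
  expR (- (expR (t - x) / (1 - t * expR (t - x)))) <=
  \prod_(k <- iota a.+1 (n - a)) (1 - expR (- t) ^+ k) <=
  expR (- (expR (- x) * (1 - t) - 2 * t)).
Proof.
move=> t0 t1 an /andP[ax xa] qn eta1.
set q := expR (- t).
have q0 : 0 < q := expR_gt0 _.
have q1 : q < 1 by rewrite /q expR_lt1 oppr_lt0.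
have qE m : q ^+ m = expR (- (t * m%:R)) by rewrite -expRM_natr mulNr.
have tE : t = expR (ln t) by rewrite lnK.
have qa1 : t * expR (- x) <= q ^+ a.
  by rewrite {1}tE -expRD qE ler_expR; lra.
have qa2 : q ^+ a <= t * expR (t - x).
  rewrite {1}tE -expRD qE ler_expR; move: xa; rewrite -natr1; lra.
have /andP[g1 g2] := expRN_odds_bounds t0; rewrite -/q in g1 g2.
set g := q / (1 - q) in g1 g2.
have g0 : 0 <= g by rewrite divr_ge0// ?subr_ge0 ltW.
have SE := sum_iota_exp a (n - a) t0; rewrite -/q -/g in SE.
set S := \sum_(k <- _) _ in SE.
have qna : 0 <= q ^+ (n - a) <= 1 by rewrite exprn_ge0 ?exprn_ile1 ?ltW.
have qa0 : 0 <= q ^+ a by rewrite exprn_ge0 ?ltW.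
have S1 : S <= expR (t - x).
  rewrite SE; apply: (@le_trans _ _ (q ^+ a * g)).
    rewrite ler_piMr//; first exact: mulr_ge0 qa0 g0.
    by case/andP: qna => *; lra.
  rewrite (_ : expR _ = t * expR (t - x) * t^-1); last by field; rewrite gt_eqF.
  exact: ler_pM.
have S2 : expR (- x) * (1 - t) - 2 * t <= S.
  have -> : S = q ^+ a * g - q ^+ n * g.
    by rewrite SE -[in RHS](subnKC an) exprD; ring.
  apply: lerB.
    apply: (@le_trans _ _ (t * expR (- x) * g)); last by rewrite ler_wpM2r.
    rewrite (_ : expR (- x) * (1 - t) = t * expR (- x) * (t^-1 - 1)); last first.
      by field; rewrite gt_eqF.
    by rewrite ler_wpM2l// mulr_ge0 ?expR_ge0 ?ltW.
  rewrite (_ : 2 * t = 2 * t ^+ 2 * t^-1); last by field; rewrite gt_eqF.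
  by apply: ler_pM => //; rewrite exprn_ge0 ?ltW.
have qk k : k \in iota a.+1 (n - a) -> 0 <= q ^+ k <= t * expR (t - x).
  rewrite mem_iota => /andP[ak _]; rewrite exprn_ge0 ?(ltW q0)//=.
  by apply: le_trans qa2; rewrite ler_wiXn2l ?(ltW q0) ?(ltW q1)// ltnW.
apply/andP; split; last first.
  apply: (@le_trans _ _ (expR (- S))); last by rewrite ler_expR lerN2.
  rewrite -sumrN expR_sum big_seq [leRHS]big_seq; apply: ler_prod => k /qk/andP[k0 k1].
  by rewrite subr_ge0 expR_ge1Dx andbT; lra.
set eta := t * expR (t - x) in eta1 qk *.
apply: (@le_trans _ _ (expR (- (S / (1 - eta))))).
  by rewrite ler_expR lerN2 ler_wpM2r// invr_ge0; lra.
rewrite mulr_suml -sumrN expR_sum big_seq [leRHS]big_seq.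
apply: ler_prod => k /qk/andP[k0 k1]; rewrite expR_ge0/= expRN.
have k2 : 0 < 1 - q ^+ k by lra.
rewrite -[leRHS]invrK lef_pV2 ?posrE ?expR_gt0 ?invr_gt0//.
apply: le_trans (expR_ge1Dx _).
rewrite (_ : (1 - q ^+ k)^-1 = 1 + q ^+ k / (1 - q ^+ k)); last by field; rewrite gt_eqF.
by rewrite lerD2l ler_wpM2l// lef_pV2 ?posrE//; lra.
Qed.

Lemma prod_iota_le r a L : 0 < r ->
  0 <= \prod_(k <- iota a.+1 L) (1 + expR (- r) ^+ k) <= expR (expR (- r) ^+ a / r).
Proof.
move=> r0; set q := expR (- r).
have q0 : 0 < q := expR_gt0 _.
have q1 : q < 1 by rewrite /q expR_lt1 oppr_lt0.
apply/andP; split; first by apply: prodr_ge0 => k _; rewrite addr_ge0 ?exprn_ge0 ?ltW.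
apply: (@le_trans _ _ (expR (\sum_(k <- iota a.+1 L) q ^+ k))).
  rewrite expR_sum; apply: ler_prod => k _; rewrite expR_ge1Dx andbT.
  by rewrite addr_ge0 ?exprn_ge0 ?ltW.
rewrite ler_expR /q sum_iota_exp// -/q.
have /andP[_ h] := expRN_odds_bounds r0.
apply: (@le_trans _ _ (q ^+ a * (q / (1 - q)))).
  rewrite ler_piMr ?mulr_ge0 ?invr_ge0 ?subr_ge0 ?exprn_ge0 ?(ltW q0) ?(ltW q1)//.
  by rewrite gerBl exprn_ge0 ?ltW.
by rewrite ler_wpM2l ?exprn_ge0 ?(ltW q0).
Qed.

(** Bounding the numbers of parts by a and b drops the factors with k > a and k > b from the product
    G, which the difference operators achieve. *)
Lemma gcount_parts_prod_diff a b n : (a <= n)%N -> (b <= n)%N ->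
  (gcount (parts a ++ parts b) n)%:R = prod_diff
    (iota a.+1 (n - a) ++ iota b.+1 (n - b)) (fun m => (rev_seq p2 n m)%:R : R) 0%N.
Proof.
move=> an bn; set s1 := iota _ _ ++ _; set s2 := parts a ++ parts b.
have s10 : all (leq 1) s1 by rewrite all_cat !all_iotaS.
have s20 : all (leq 1) s2 by rewrite all_cat !all_parts.
have pE d : (d <= n)%N -> perm_eq (parts n) (iota d.+1 (n - d) ++ parts d).
  move=> dn; rewrite /parts perm_rev -{1}(subnKC dn) iotaD perm_catC add1n.
  by rewrite perm_cat2l perm_sym perm_rev.
have gE : gcount (s1 ++ s2) =1 gcount (parts n ++ parts n).
  apply: gcount_perm; first by rewrite all_cat s10.
  rewrite perm_sym (permPl (perm_cat (pE _ an) (pE _ bn))).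
  by rewrite /s1 /s2 -!catA perm_cat2l perm_catCA.
have := prod_diff_gcount R s2 n s10 => /(congr1 (fun F => F 0%N)).
rewrite {2}/rev_seq subn0/= => <-; congr (prod_diff _ _ _); apply/funext => m.
rewrite (eq_rev_seq _ _ gE) /rev_seq; case: leqP => // mn.
by rewrite gcount_p2// leq_subr.
Qed.

Lemma PnE a b n : Pn R n [set u | (size (lambda_minus u) <= a)%N /\
    (size (lambda_plus u) <= b)%N] = (gcount (parts a ++ parts b) n)%:R / (p2 n)%:R.
Proof.
rewrite /Pn /uniform_prob; congr (_%:R / _%:R).
  exact: card_concave_compositions.
exact: card_concave_compositions_all.
Qed.

Lemma Pn_approx a b n (eps q r : R) : (a <= n)%N -> (b <= n)%N -> 0 <= r ->
  (forall m, `|ratio R n m - q ^+ m| <= eps * r ^+ m) ->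
  `|Pn R n [set u | (size (lambda_minus u) <= a)%N /\
      (size (lambda_plus u) <= b)%N] -
    (\prod_(k <- iota a.+1 (n - a)) (1 - q ^+ k)) *
    (\prod_(k <- iota b.+1 (n - b)) (1 - q ^+ k))| <=
  eps * ((\prod_(k <- iota a.+1 (n - a)) (1 + r ^+ k)) *
    (\prod_(k <- iota b.+1 (n - b)) (1 + r ^+ k))).
Proof.
move=> an bn r0 H; have p0 := p2R_gt0 R n.
rewrite PnE gcount_parts_prod_diff//.
have H' m : `|(rev_seq p2 n m)%:R - (p2 n)%:R * q ^+ m| <= (p2 n)%:R * eps * r ^+ m.
  have -> : (rev_seq p2 n m)%:R - (p2 n)%:R * q ^+ m =
      (p2 n)%:R * (ratio R n m - q ^+ m).
    by rewrite mulrBr /ratio mulrCA divff ?mulr1// gt_eqF.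
  by rewrite normrM (gtr0_norm p0) -mulrA ler_wpM2l// ltW.
have := prod_diff_le (iota a.+1 (n - a) ++ iota b.+1 (n - b)) r0 H' 0%N.
rewrite !expr0 !mulr1 !big_cat/=.
set D := prod_diff _ _ _; set A := \prod_(k <- iota a.+1 _) _; set B := \prod_(k <- iota b.+1 _) _.
rewrite -[X in `|X|](@divfK _ (p2 n)%:R) ?gt_eqF// normrM (gtr0_norm p0).
rewrite mulrBl -[_ * (A * B) / _]mulrAC divff ?gt_eqF// mul1r -mulrA mulrC ler_pM2l//.
Qed.
End Limit.

(** * Asymptotics *)

Section Asymptotics.
Variable R : realType.
Local Notation c := (saddle R).

Definition lg (n : nat) : R := ln n%:R / 32.

Section FixedIndex.
Variables (n : nat) (x : R).
Local Notation l := (lg n).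
Local Notation z := (expR l).
Local Notation t := (tilt z).
Hypothesis l_ge : 201 * 128 <= l.
Hypothesis x_le : `|x| + 2 <= l.

Let c13 : 1 <= c <= 3 := saddle_bounds R.

Let xl : - l + 2 <= x <= l - 2.
Proof. by have := x_le; rewrite -lerBrDr ler_norml => /andP[h1 h2]; apply/andP; split; lra. Qed.

Lemma zX32 : z ^+ 32 = n%:R.
Proof.
rewrite -expRM_natl /lg mulrCA divff ?mulr1 ?lnK ?posrE// ltr0n lt0n.
(* [ln] takes the default value 0 at 0, so that n = 0 contradicts the lower bound on [lg n]. *)
by apply/eqP => n0; move: l_ge; rewrite /lg n0 ln0// mul0r; lra.
Qed.

Lemma z_ge : 201 * 128 <= z.
Proof. by have := expR_ge1Dx l; have := l_ge; lra. Qed.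

Lemma lg_sq_le : l ^+ 2 <= 2 * z.
Proof.
have l0 : 0 <= l by have := l_ge; lra.
have := expR_ge1Dxn 1 l0; rewrite (_ : 2`!%:R = 2 :> R)//; lra.
Qed.

Let t0 : 0 < t := tilt_gt0 z_ge.

Let ln_tilt : - (16 * l) <= ln t <= 2 - 16 * l.
Proof.
case/andP: c13 => c1 c3.
have -> : ln t = ln c - 16 * l.
  by rewrite /tilt ln_div ?posrE ?exprn_gt0 ?expR_gt0 ?saddle_gt0// -expRM_natl expRK.
have h1 := ln_ge0 c1.
have h2 : ln c <= 2.
  rewrite -[c](subrK 1) addrC; apply: le_trans (le_ln1Dx _) _; lra.
by apply/andP; split; lra.
Qed.

Lemma tilt_le : t <= expR (2 - 16 * l).
Proof. by case/andP: ln_tilt => _; rewrite -ler_expR lnK. Qed.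

Lemma tilt_le_lgV : t <= l^-1.
Proof.
have l0 : 0 < l by have := l_ge; lra.
by apply: (le_trans tilt_le); apply: le_trans (expRN_le l0); rewrite ler_expR; have := l_ge; lra.
Qed.

Lemma tilt_le1 : t <= 1.
Proof. by apply: (le_trans tilt_le); rewrite -[leRHS]expR0 ler_expR; have := l_ge; lra. Qed.

(** sqrt (3 n) / pi is 1 / t, so that q^(f_n(x)) is exactly t e^(-x). *)
Lemma fE : f_ n x = (x - ln t) / t.
Proof.
have z16 : 0 < z ^+ 16 by rewrite exprn_gt0 ?expR_gt0.
have s3 : 0 < Num.sqrt 3 :> R by rewrite sqrtr_gt0.
have tV : Num.sqrt (3 * n%:R) / pi = t^-1.
  rewrite sqrtrM// -zX32 (_ : 32%N = (16 * 2)%N)// exprM sqrtr_sqr (gtr0_norm z16).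
  by rewrite /tilt /saddle !invf_div [_ * z ^+ 16]mulrC mulrA.
by rewrite /f_ tV lnV ?posrE//; ring.
Qed.

Lemma f_ge0 : 0 <= f_ n x.
Proof.
rewrite fE divr_ge0 ?(ltW t0)//.
by case/andP: ln_tilt => h1 h2; case/andP: xl => h3 h4; have := l_ge; lra.
Qed.

Local Notation a := (Num.truncn (f_ n x)).

Lemma trunc_f_bounds : t * a%:R <= x - ln t < t * a.+1%:R.
Proof.
have := truncnS_gt (f_ n x); have := truncn_le (f_ n x); rewrite f_ge0.
rewrite [X in _ <= X]fE [X in X < _]fE ler_pdivlMr// ltr_pdivrMr//.
by rewrite [t * _]mulrC [t * _]mulrC => -> ->.
Qed.

Lemma trunc_f_le : (a <= n)%N.
Proof.
rewrite -(ler_nat R) -(ler_pM2l t0).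
case/andP: trunc_f_bounds => h _; apply: (le_trans h).
have -> : t * n%:R = c * z ^+ 16.
  by rewrite /tilt -zX32 (_ : 32%N = (16 + 16)%N)// exprD mulrA divfK// gt_eqF ?exprn_gt0 ?expR_gt0.
case/andP: c13 => c1 c3; case/andP: ln_tilt => h1 h2; case/andP: xl => h3 h4.
have zl := expR_ge1Dx l.
have zz : 20 * z <= z ^+ 16.
  have z1 : 1 <= z by have := l_ge; lra.
  apply: (@le_trans _ _ (z ^+ 2)); last by rewrite ler_weXn2l.
  by rewrite expr2 ler_wpM2r ?expR_ge0//; have := l_ge; lra.
have : 1 * z ^+ 16 <= c * z ^+ 16 by rewrite ler_wpM2r ?exprn_ge0 ?expR_ge0.
by have := l_ge; lra.
Qed.

(** For y = t n = c^2 / t, e^(-y) <= 2 / y^2 and y >= 1 / t. *)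
Lemma tilt_expn_le : expR (- t) ^+ n <= 2 * t ^+ 2.
Proof.
rewrite -expRM_natr mulNr -(saddle_tilt z_ge zX32) expRN.
case/andP: c13 => c1 c3.
have c2 : 1 <= c ^+ 2 by rewrite exprn_ege1.
have y0 : 0 <= c ^+ 2 / t by rewrite divr_ge0 ?sqr_ge0 ?(ltW t0).
have := expR_ge1Dxn 1 y0; rewrite (_ : 2`!%:R = 2 :> R)// => h.
have tv : t^-1 <= c ^+ 2 / t by rewrite ler_peMl// invr_ge0 ltW.
have tv2 : (t^-1) ^+ 2 <= (c ^+ 2 / t) ^+ 2.
  by rewrite lerXn2r ?nnegrE ?invr_ge0 ?(ltW t0).
have t20 : 0 < (2 * t ^+ 2)^-1 by rewrite invr_gt0 mulr_gt0// exprn_gt0.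
rewrite -[leRHS]invrK lef_pV2 ?posrE ?expR_gt0//.
by apply: le_trans h; rewrite invfM -exprVn; lra.
Qed.

Lemma tilt_expR_lt1 : t * expR (t - x) < 1.
Proof.
apply: (@le_lt_trans _ _ (expR (2 - 16 * l) * expR (1 + l))).
  apply: ler_pM; rewrite ?expR_ge0 ?(ltW t0) ?tilt_le//.
  by rewrite ler_expR; have := tilt_le1; case/andP: xl => h3 h4; lra.
by rewrite -expRD expR_lt1; have := l_ge; lra.
Qed.

Local Notation r := (t - 2 / ((step z)%:R * l)).

Lemma rate_ge : t / 2 <= r.
Proof.
have /andP[h1 h2] := step_bounds z_ge.
have l0 : 0 < l by have := l_ge; lra.
have z16 : 0 < z ^+ 16 by rewrite exprn_gt0 ?expR_gt0.
have s0 : 0 < (step z)%:R :> R by apply: lt_le_trans h1; rewrite divr_gt0.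
suff : 2 / ((step z)%:R * l) <= t / 2 by lra.
rewrite ler_pdivrMr; last exact: mulr_gt0 s0 l0.
apply: (@le_trans _ _ (t / 2 * (z ^+ 16 / 2 * l))).
  have -> : t / 2 * (z ^+ 16 / 2 * l) = c * l / 4.
    by rewrite /tilt; field; rewrite gt_eqF ?expR_gt0.
  case/andP: c13 => c1 c3.
  have : 1 * l <= c * l by rewrite ler_wpM2r// ltW.
  by have := l_ge; lra.
apply: ler_wpM2l; first by rewrite divr_ge0 ?(ltW t0).
by apply: ler_wpM2r => //; exact: ltW.
Qed.

Lemma rate_gt0 : 0 < r.
Proof. by apply: lt_le_trans rate_ge; rewrite divr_gt0. Qed.

(** Since a is at most 17 l sqrt n, the slack 2 / (step l) in the rate changes the exponent by at
    most 68; one more comes from rounding f_n(x) down. This is why the slack is divided by ln z. *)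
Lemma rate_prod_le : expR (- r) ^+ a / r <= 2 * expR (69 - x).
Proof.
have l0 : 0 < l by have := l_ge; lra.
have /andP[h1 h2] := step_bounds z_ge.
have z16 : 0 < z ^+ 16 by rewrite exprn_gt0 ?expR_gt0.
have s0 : 0 < (step z)%:R :> R by apply: lt_le_trans h1; rewrite divr_gt0.
case/andP: trunc_f_bounds => ta1 ta2; case/andP: ln_tilt => lt1 lt2.
case/andP: xl => xl1 xl2; case/andP: c13 => c1 c3.
have e68 : 2 / ((step z)%:R * l) * a%:R <= 68.
  rewrite mulrAC ler_pdivrMr; last exact: mulr_gt0 s0 l0.
  apply: (@le_trans _ _ (68 * (z ^+ 16 / 2 * l))); last first.
    by apply: ler_wpM2l => //; apply: ler_wpM2r => //; exact: ltW.
  have az : a%:R <= z ^+ 16 * (17 * l).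
    rewrite -(ler_pM2l t0); apply: (le_trans ta1).
    have -> : t * (z ^+ 16 * (17 * l)) = c * (17 * l).
      by rewrite /tilt; field; rewrite gt_eqF ?expR_gt0.
    have : 1 * (17 * l) <= c * (17 * l) by apply: ler_wpM2r => //; have := l0; lra.
    by lra.
  lra.
apply: (@le_trans _ _ (t * expR (69 - x) / (t / 2))); last first.
  by rewrite le_eqVlt; apply/orP; left; apply/eqP; field; rewrite gt_eqF.
apply: ler_pM; rewrite ?exprn_ge0 ?expR_ge0 ?invr_ge0 ?(ltW rate_gt0)//.
  rewrite -[X in _ <= X * _]lnK ?posrE// -expRD -expRM_natr ler_expR.
  have := tilt_le1; move: ta2; rewrite -[a.+1%:R]natr1; lra.
by rewrite lef_pV2 ?posrE; [exact: rate_ge|exact: rate_gt0|rewrite divr_gt0].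
Qed.

Lemma main_prod_bounds :
  expR (- (expR (t - x) / (1 - t * expR (t - x)))) <=
  \prod_(k <- iota a.+1 (n - a)) (1 - expR (- t) ^+ k) <=
  expR (- (expR (- x) * (1 - t) - 2 * t)).
Proof.
by apply: prod_iota_bounds; [exact: t0|exact: tilt_le1|exact: trunc_f_le|
  exact: trunc_f_bounds|exact: tilt_expn_le|exact: tilt_expR_lt1].
Qed.

Lemma error_prod_bounds :
  0 <= \prod_(k <- iota a.+1 (n - a)) (1 + expR (- r) ^+ k) <=
  expR (2 * expR (69 - x)).
Proof.
have /andP[-> h] := prod_iota_le a (n - a) rate_gt0; apply: (le_trans h).
by rewrite ler_expR rate_prod_le.
Qed.

(** Nonnegativity of f_n(x) matters: a negative bound would truncate to 0 and let the empty
    partition through. *)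
Lemma size_le_f (s : seq nat) : ((size s)%:R <= f_ n x) = (size s <= a)%N.
Proof. by rewrite truncn_ge_nat// f_ge0. Qed.

End FixedIndex.

Lemma lg_cvgy (B : R) : \forall n \near \oo, B <= lg n.
Proof.
near=> n.
have h : expR (32 * B) <= n%:R by near: n; exact: nbhs_infty_ger.
rewrite /lg ler_pdivlMr// mulrC -ler_expR lnK// posrE.
exact: lt_le_trans (expR_gt0 _) h.
Unshelve. all: by end_near. Qed.

Local Notation tn := (fun n => tilt (expR (lg n))).

Lemma lgV_cvg : (lg n)^-1 @[n --> \oo] --> (0 : R).
Proof.
apply/cvgrPdist_le => e e0; near=> n.
have h : e^-1 <= lg n by near: n; exact: lg_cvgy.
have l0 : 0 < lg n by apply: lt_le_trans h; rewrite invr_gt0.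
rewrite sub0r normrN gtr0_norm ?invr_gt0//.
by rewrite -[leRHS]invrK lef_pV2 ?posrE ?invr_gt0.
Unshelve. all: by end_near. Qed.

Lemma tilt_cvg : tn n @[n --> \oo] --> (0 : R).
Proof.
apply: (squeeze_cvgr _ (cvg_cst (0 : R)) lgV_cvg); near=> n.
have h : 201 * 128 <= lg n by near: n; exact: lg_cvgy.
by rewrite (ltW (tilt_gt0 (z_ge h))) tilt_le_lgV.
Unshelve. all: by end_near. Qed.

Lemma main_prod_cvg (x : R) :
  (fun n => \prod_(k <- iota (Num.truncn (f_ n x)).+1 (n - Num.truncn (f_ n x)))
     (1 - expR (- tn n) ^+ k)) @ \oo --> expR (- expR (- x)).
Proof.
have e_cvg : expR (tn n - x) @[n --> \oo] --> expR (- x).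
  have -> : expR (- x) = expR (0 - x) by rewrite sub0r.
  apply: continuous_cvg; first exact: continuous_expR.
  exact: cvgB tilt_cvg (cvg_cst x).
have d_cvg : 1 - tn n * expR (tn n - x) @[n --> \oo] --> (1 : R).
  have := cvgB (cvg_cst (1 : R)) (cvgM tilt_cvg e_cvg).
  by rewrite mul0r subr0; apply.
have lo : expR (- (expR (tn n - x) / (1 - tn n * expR (tn n - x)))) @[n --> \oo]
    --> expR (- expR (- x)).
  apply: continuous_cvg; first exact: continuous_expR.
  apply: cvgN; have := cvgM e_cvg (cvgV (oner_neq0 R) d_cvg).
  by rewrite invr1 mulr1; apply.
have hi : expR (- (expR (- x) * (1 - tn n) - 2 * tn n)) @[n --> \oo]
    --> expR (- expR (- x)).
  apply: continuous_cvg; first exact: continuous_expR.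
  apply: cvgN; have := cvgB (cvgM (cvg_cst (expR (- x)))
    (cvgB (cvg_cst (1 : R)) tilt_cvg)) (cvgM (cvg_cst (2 : R)) tilt_cvg).
  by rewrite !subr0 mulr0 subr0 mulr1; apply.
apply: (squeeze_cvgr _ lo hi); near=> n.
by apply: main_prod_bounds; near: n; exact: lg_cvgy.
Unshelve. all: by end_near. Qed.

(** [ratio_approx] enters through [Pn_approx]: the error products stay bounded, and l^2 <= 2 z turns
    160 l / z into 320 / l. *)
Lemma Pn_error_bound (x y : R) n : 201 * 128 <= lg n -> `|x| + 2 <= lg n ->
  `|y| + 2 <= lg n ->
  `|Pn R n [set t | (size (lambda_minus t))%:R <= f_ n x /\
                    (size (lambda_plus t))%:R <= f_ n y] -
    (\prod_(k <- iota (Num.truncn (f_ n x)).+1 (n - Num.truncn (f_ n x)))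
      (1 - expR (- tn n) ^+ k)) *
    (\prod_(k <- iota (Num.truncn (f_ n y)).+1 (n - Num.truncn (f_ n y)))
      (1 - expR (- tn n) ^+ k))| <=
  320 * (expR (2 * expR (69 - x)) * expR (2 * expR (69 - y))) * (lg n)^-1.
Proof.
move=> hl hx hy.
have l0 : 0 < lg n by have := hl; lra.
set E := [set _ | _].
have -> : E = [set t | (size (lambda_minus t) <= Num.truncn (f_ n x))%N /\
                    (size (lambda_plus t) <= Num.truncn (f_ n y))%N].
  by apply/seteqP; split=> t; rewrite /E/= (size_le_f hl hx) (size_le_f hl hy).
have hz := z_ge hl.
have sq := lg_sq_le hl; rewrite expr2 in sq.
have z0 := expR_gt0 (lg n).
have lz : 1000 * lg n <= expR (lg n).
  have : 2000 * lg n <= lg n * lg n by rewrite ler_pM2r//; lra.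
  by lra.
have H := @ratio_approx R n (expR (lg n)) hz (zX32 hl).
rewrite expRK in H; have {}H := H _ lz.
have H1 : 1 <= lg n by lra.
have {H1}H := H H1.
apply: le_trans (Pn_approx (trunc_f_le hl hx) (trunc_f_le hl hy) (expR_ge0 _) H) _.
have /andP[a0 a1] := error_prod_bounds hl hx.
have /andP[b0 b1] := error_prod_bounds hl hy.
rewrite [leRHS]mulrAC [- tilt _ + _](_ : _ = - (tilt (expR (lg n)) -
  2 / ((step (expR (lg n)))%:R * lg n))); last by rewrite opprB addrC.
apply: ler_pM.
- by rewrite divr_ge0 ?(ltW z0)// mulr_ge0// (ltW l0).
- exact: mulr_ge0.
- rewrite ler_pdivrMr// mulrAC ler_pdivlMr//; lra.
- exact: ler_pM.
Qed.
End Asymptotics.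

Theorem theorem5p1 (R : realType) (x y : R) :
  (fun n : nat =>
     Pn R n [set t | (size (lambda_minus t))%:R <= f_ n x /\
                     (size (lambda_plus t))%:R <= f_ n y])
    @ \oo --> expR (- (expR (- x) + expR (- y))).
Proof.
set P := fun n : nat => _.
(* [M] arises by replacing each p(n - m) / p(n) by q^m; it has the claimed limit, and its distance
   to [P] tends to 0. *)
pose M n := (\prod_(k <- iota (Num.truncn (f_ n x)).+1 (n - Num.truncn (f_ n x)))
      (1 - expR (- tilt (expR (lg R n))) ^+ k)) *
    (\prod_(k <- iota (Num.truncn (f_ n y)).+1 (n - Num.truncn (f_ n y)))
      (1 - expR (- tilt (expR (lg R n))) ^+ k)).
have M_cvg : M n @[n --> \oo] --> expR (- (expR (- x) + expR (- y))).
  have := cvgM (@main_prod_cvg R x) (@main_prod_cvg R y).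
  by rewrite -expRD -opprD; apply.
have PM_cvg : P n - M n @[n --> \oo] --> (0 : R).
  apply: norm_cvg0.
  pose K : R := 320 * (expR (2 * expR (69 - x)) * expR (2 * expR (69 - y))).
  have K_cvg : K * (lg R n)^-1 @[n --> \oo] --> (0 : R).
    by have := cvgM (cvg_cst K) (@lgV_cvg R); rewrite mulr0; apply.
  apply: (squeeze_cvgr _ (cvg_cst (0 : R)) K_cvg); near=> n.
  rewrite normr_ge0/=; apply: Pn_error_bound; near: n; exact: lg_cvgy.
have -> : P = fun n => (P n - M n) + M n by apply/funext => n; rewrite subrK.
by have := cvgD PM_cvg M_cvg; rewrite add0r; apply.
Unshelve. all: by end_near. Qed.
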